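(* Let $k$ be a commutative Noetherian ring whose finitistic dimension $\mathrm{findim}\, k$ is finite, and let $V$ be a finitely generated $\mathscr{C}$-module with $\mathrm{gd}(V)=n$. For each $i$ let $V^i$ be the submodule of $V$ generated by $\bigoplus_{j\leqslant i}V_j$ (so $V^{-1}=0$). Then the projective dimension $\mathrm{pd}(V)$ is finite if and only if for $0\leqslant i\leqslant n$ one has $$V^i/V^{i-1}\cong\underline{\mathscr{C}}\otimes_{kS_i}(V^i/V^{i-1})_i \quad\text{and}\quad \mathrm{pd}_{kS_i}((V^i/V^{i-1})_i)<\infty.$$ Moreover, in that case $$\mathrm{pd}(V)=\max\{\mathrm{pd}_{kS_i}((V^i/V^{i-1})_i)\}_{i=0}^n=\max\{\mathrm{pd}_{k}((V^i/V^{i-1})_i)\}_{i=0}^n\leqslant\mathrm{findim}\,k.$$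
   Context: $\mathscr{C}$ is the category with objects $[n]=\{1,\dots,n\}$, $n\in\mathbb{Z}_+=\{0,1,2,\dots\}$ ($[0]=\emptyset$), and morphisms the injections (a skeleton of FI); the object $[n]$ is also written $n$. $\underline{\mathscr{C}}$ is its $k$-linearization, so $\underline{\mathscr{C}}(i,j)$ is the free $k$-module on $\mathscr{C}(i,j)$, and $\underline{\mathscr{C}}(i,i)=kS_i$. A $\mathscr{C}$-module is a covariant functor $V$ from $\mathscr{C}$ to $k$-modules, $V_i$ being its value at $[i]$. It is finitely generated if it is a quotient of a finite direct sum of modules $\underline{\mathscr{C}}(i,-)$. $\mathrm{pd}(V)$ is the projective dimension of $V$ in the category of $\mathscr{C}$-modules. For a $kS_i$-module $T$, $\underline{\mathscr{C}}\otimes_{kS_i}T$ is the $\mathscr{C}$-module $m\mapsto\underline{\mathscr{C}}(i,m)\otimes_{kS_i}T$. The generating degree $\mathrm{gd}(V)$ is the largest $i$ with $H_0(V)_i\neq 0$ ($-\infty$ if $H_0(V)=0$), where $H_0(V)$ is the quotient of $V$ with $H_0(V)_i=V_i/\sum_{j<i}\underline{\mathscr{C}}(j,i)V_j$. The finitistic dimension $\mathrm{findim}\,k$ is the supremum of $\mathrm{pd}_k(T)$ over all finitely generated $k$-modules $T$ with $\mathrm{pd}_k(T)<\infty$. *)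

(* Defs.v *)
From HB Require Import structures.
From mathcomp Require Import all_boot all_order all_algebra.
From mathcomp Require Import boolp classical_sets.
From mathcomp Require Export constructive_ereal.

Set Implicit Arguments.
Unset Strict Implicit.
Unset Printing Implicit Defensive.

Import Order.TTheory GRing.Theory Num.Theory.

Local Open Scope ring_scope.
Local Open Scope classical_set_scope.

Definition surjective (A B : Type) (f : A -> B) : Prop :=
  forall y, exists x, f x = y.

Record submod (R : pzRingType) (M : lmodType R) := Submod {
  in_submod :> {pred M};
  submod_closedP : submod_closed in_submod }.

Lemma submod_semi (R : pzRingType) (M : lmodType R) (S : submod M) :
  subsemimod_closed (in_submod S).
Proof. exact: GRing.submod_closed_semi (submod_closedP S). Qed.

HB.instance Definition _ (R : pzRingType) (M : lmodType R) (S : submod M) :=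
  GRing.isSubmodClosed.Build R M (in_submod S) (submod_semi S).

Section GeneratedSubmodule.
Variables (R : pzRingType) (M : lmodType R) (G : set M).

Definition gen_pred : {pred M} :=
  [pred x : M | `[< forall S : submod M, (forall y, G y -> y \in S) -> x \in S >]].

Lemma gen_pred_closed : submod_closed gen_pred.
Proof.
split=> [|a x y /asboolP hx /asboolP hy]; apply/asboolP => S hS.
  exact: rpred0.
by apply: rpredD; [apply: rpredZ; apply: hx | apply: hy].
Qed.

Definition gen_submod : submod M := Submod gen_pred_closed.

End GeneratedSubmodule.

Section Submodule.
Variables (R : pzRingType) (M : lmodType R) (S : submod M).

Definition subm : Type := {x : M | x \in S}.

HB.instance Definition _ := SubChoice.on subm.
HB.instance Definition _ := GRing.SubChoice_isSubLmodule.Build R M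
  (in_submod S) subm (submod_semi S).

End Submodule.

Section Quotient.
Variables (R : pzRingType) (M : lmodType R) (S : submod M).
Local Open Scope quotient_scope.

Definition quotm : Type := Quotient.quot (in_submod S).

HB.instance Definition _ := GRing.Zmodule.on quotm.

Definition quotm_pi (x : M) : quotm := \pi_(Quotient.quot (in_submod S)) x.
Definition quotm_repr (x : quotm) : M :=
  repr (x : Quotient.quot (in_submod S)).

Lemma quotm_reprK : cancel quotm_repr quotm_pi.
Proof. by move=> x; rewrite /quotm_pi /quotm_repr reprK. Qed.

Lemma quotm_eq x y : (quotm_pi x = quotm_pi y) <-> (x - y \in S).
Proof.
rewrite /quotm_pi.
by split=> [/eqP|h]; [|apply/eqP]; rewrite -Quotient.idealrBE.
Qed.

Lemma quotm_piD x y : quotm_pi (x + y) = quotm_pi x + quotm_pi y.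
Proof. by rewrite /quotm_pi raddfD. Qed.

Lemma quotm_rel x : x - quotm_repr (quotm_pi x) \in S.
Proof. by apply/quotm_eq; rewrite quotm_reprK. Qed.

Definition quotm_scale (a : R) (x : quotm) : quotm :=
  quotm_pi (a *: quotm_repr x).

Lemma quotm_scale_pi a x : quotm_scale a (quotm_pi x) = quotm_pi (a *: x).
Proof.
apply/quotm_eq; rewrite -scalerBr rpredZ //.
by rewrite -opprB rpredN quotm_rel.
Qed.

Lemma quotm_ind (P : quotm -> Prop) : (forall x, P (quotm_pi x)) -> forall x, P x.
Proof. by move=> h x; rewrite -[x]quotm_reprK. Qed.

Fact quotm_scaleA a b x :
  quotm_scale a (quotm_scale b x) = quotm_scale (a * b) x.
Proof. by elim/quotm_ind: x => x; rewrite !quotm_scale_pi scalerA. Qed.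
Fact quotm_scale1 : left_id 1 quotm_scale.
Proof. by elim/quotm_ind=> x; rewrite quotm_scale_pi scale1r. Qed.
Fact quotm_scaleDr : right_distributive quotm_scale +%R.
Proof.
move=> a; elim/quotm_ind=> x; elim/quotm_ind=> y.
by rewrite -quotm_piD !quotm_scale_pi scalerDr quotm_piD.
Qed.
Fact quotm_scaleDl x : {morph quotm_scale^~ x : a b / a + b}.
Proof.
by move=> a b; elim/quotm_ind: x => x; rewrite !quotm_scale_pi scalerDl quotm_piD.
Qed.

HB.instance Definition _ := GRing.Zmodule_isLmodule.Build R quotm
  quotm_scaleA quotm_scale1 quotm_scaleDr quotm_scaleDl.

Fact quotm_pi_linear : linear quotm_pi.
Proof. by move=> a x y; rewrite quotm_piD -quotm_scale_pi. Qed.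

HB.instance Definition _ := GRing.isLinear.Build R M quotm *:%R quotm_pi
  quotm_pi_linear.

End Quotient.

Section InducedMaps.
Variables (R : pzRingType) (M N : lmodType R) (S : submod M) (S' : submod N).
Variables (f : M -> N) (flin : linear f).
Hypothesis fS : forall x, x \in S -> f x \in S'.

Definition subm_map (x : subm S) : subm S' := exist _ (f (val x)) (fS (valP x)).

Lemma subm_map_linear : linear subm_map.
Proof. by move=> a x y; apply/val_inj; rewrite /= flin. Qed.

Definition quotm_map (x : quotm S) : quotm S' :=
  quotm_pi S' (f (quotm_repr x)).

Lemma linB x y : f (x - y) = f x - f y.
Proof. by rewrite -scaleN1r addrC flin scaleN1r addrC. Qed.

Lemma quotm_map_pi x : quotm_map (quotm_pi S x) = quotm_pi S' (f x).
Proof.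
apply/quotm_eq; rewrite -linB; apply: fS.
by rewrite -opprB rpredN quotm_rel.
Qed.

Lemma quotm_map_linear : linear quotm_map.
Proof.
move=> a; elim/quotm_ind=> x; elim/quotm_ind=> y.
by rewrite -linearP !quotm_map_pi flin linearP.
Qed.

End InducedMaps.

Definition projective (R : pzRingType) (P : lmodType R) : Prop :=
  forall (M N : lmodType R) (g : {linear M -> N}) (f : {linear P -> N}),
    surjective g -> exists h : {linear P -> M}, forall x, g (h x) = f x.

(* M has a projective resolution 0 -> P_n -> ... -> P_0 -> M -> 0 *)
Definition proj_res (R : pzRingType) (M : lmodType R) (n : nat) : Prop :=
  exists (P : nat -> lmodType R) (d : forall i, {linear P i.+1 -> P i})
         (e : {linear P 0 -> M}),
    [/\ forall i, projective (P i),
        forall i, (n < i)%N -> forall x : P i, x = 0,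
        surjective e,
        forall x, e x = 0 <-> exists y, d 0 y = x
      & forall i x, d i x = 0 <-> exists y, d i.+1 y = x].

Definition ext_nat (n : nat) : \bar int := (n%:Z)%:E.

(* With this convention pd 0 = 0. *)
Definition pd (R : pzRingType) (M : lmodType R) : \bar int :=
  infimum +oo%E [set ext_nat n | n in [set n | proj_res M n]].

Definition fin_gen (R : pzRingType) (M : lmodType R) : Prop :=
  exists (r : nat) (g : 'I_r -> M),
    forall x, exists c : 'I_r -> R, x = \sum_j c j *: g j.

(* Submodules of the regular module are the ideals, as k is commutative. *)
Definition noetherian (k : comNzRingType) : Prop :=
  forall I : submod k^o, fin_gen (subm I).

Definition findim (k : comNzRingType) : \bar int :=
  supremum -oo%E
    [set d | exists T : lmodType k, [/\ fin_gen T, pd T = d & (d < +oo)%E]].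

Definition inj_ord (m n : nat) : predArgType :=
  {f : {ffun 'I_m -> 'I_n} | injectiveb f}.

HB.instance Definition _ m n := SubFinite.on (inj_ord m n).

Definition inj_ord_fun m n (f : inj_ord m n) : 'I_m -> 'I_n := val f.
Coercion inj_ord_fun : inj_ord >-> Funclass.

Lemma inj_ord_inj m n (f : inj_ord m n) : injective f.
Proof. exact/injectiveP/(valP f). Qed.

Lemma inj_ordP m n (f g : inj_ord m n) : f =1 g -> f = g.
Proof. by move=> h; apply/val_inj/ffunP. Qed.

Fact inj_ord_id_subproof m : injectiveb [ffun x : 'I_m => x].
Proof. by apply/injectiveP => x y; rewrite !ffunE. Qed.
Definition inj_ord_id m : inj_ord m m :=
  exist (fun f : {ffun _ -> _} => injectiveb f) _ (inj_ord_id_subproof m).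

Fact inj_ord_comp_subproof m n p (g : inj_ord n p) (f : inj_ord m n) :
  injectiveb [ffun x => g (f x)].
Proof. by apply/injectiveP => x y; rewrite !ffunE => /inj_ord_inj/inj_ord_inj. Qed.
Definition inj_ord_comp m n p (g : inj_ord n p) (f : inj_ord m n) : inj_ord m p :=
  exist (fun f : {ffun _ -> _} => injectiveb f) _ (inj_ord_comp_subproof g f).

Lemma inj_ord_idE m x : inj_ord_id m x = x. Proof. by rewrite /inj_ord_fun /= ffunE. Qed.
Lemma inj_ord_compE m n p (g : inj_ord n p) (f : inj_ord m n) x :
  inj_ord_comp g f x = g (f x).
Proof. by rewrite /inj_ord_fun /= ffunE. Qed.

Lemma inj_ord_compA m n p q (h : inj_ord p q) (g : inj_ord n p) (f : inj_ord m n) :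
  inj_ord_comp h (inj_ord_comp g f) = inj_ord_comp (inj_ord_comp h g) f.
Proof. by apply: inj_ordP => x; rewrite !inj_ord_compE. Qed.
Lemma inj_ord_comp1l m n (f : inj_ord m n) : inj_ord_comp (inj_ord_id n) f = f.
Proof. by apply: inj_ordP => x; rewrite !inj_ord_compE inj_ord_idE. Qed.
Lemma inj_ord_comp1r m n (f : inj_ord m n) : inj_ord_comp f (inj_ord_id m) = f.
Proof. by apply: inj_ordP => x; rewrite !inj_ord_compE inj_ord_idE. Qed.

Record fimod (k : comNzRingType) := FIMod {
  fi_ob :> nat -> lmodType k;
  fi_map : forall m n, inj_ord m n -> fi_ob m -> fi_ob n;
  fi_map_linear : forall m n (f : inj_ord m n), linear (fi_map f);
  fi_map_id : forall m (x : fi_ob m), fi_map (inj_ord_id m) x = x;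
  fi_map_comp : forall m n p (g : inj_ord n p) (f : inj_ord m n) (x : fi_ob m),
    fi_map (inj_ord_comp g f) x = fi_map g (fi_map f x) }.

HB.instance Definition _ (k : comNzRingType) (V : fimod k) m n (f : inj_ord m n) :=
  GRing.isLinear.Build k (V m) (V n) *:%R (fi_map f) (fi_map_linear f).

Record fihom (k : comNzRingType) (V W : fimod k) := FIHom {
  fi_hom :> forall n, V n -> W n;
  fi_hom_linear : forall n, linear (@fi_hom n);
  fi_hom_nat : forall m n (f : inj_ord m n) (x : V m),
    fi_hom (fi_map f x) = fi_map f (fi_hom x) }.

Arguments fi_hom {k V W} _ n _.
Arguments fi_hom_linear {k V W} _ n.

HB.instance Definition _ (k : comNzRingType) (V W : fimod k) (h : fihom V W) n :=
  GRing.isLinear.Build k (V n) (W n) *:%R (h n) (fi_hom_linear h n).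

Definition fi_iso (k : comNzRingType) (V W : fimod k) : Prop :=
  exists (f : fihom V W) (g : fihom W V),
    forall n, cancel (f n) (g n) /\ cancel (g n) (f n).

Definition fi_surj (k : comNzRingType) (V W : fimod k) (f : fihom V W) : Prop :=
  forall n, surjective (f n).

Definition fi_projective (k : comNzRingType) (P : fimod k) : Prop :=
  forall (M N : fimod k) (g : fihom M N) (f : fihom P N),
    fi_surj g -> exists h : fihom P M, forall n x, g n (h n x) = f n x.

Definition fi_proj_res (k : comNzRingType) (V : fimod k) (n : nat) : Prop :=
  exists (P : nat -> fimod k) (d : forall i, fihom (P i.+1) (P i))
         (e : fihom (P 0) V),
    [/\ forall i, fi_projective (P i),
        forall i, (n < i)%N -> forall m (x : P i m), x = 0,
        fi_surj e,
        forall m x, e m x = 0 <-> exists y, d 0 m y = x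
      & forall i m x, d i m x = 0 <-> exists y, d i.+1 m y = x].

Definition fi_pd (k : comNzRingType) (V : fimod k) : \bar int :=
  infimum +oo%E [set ext_nat n | n in [set n | fi_proj_res V n]].

Record fisub (k : comNzRingType) (V : fimod k) := FISub {
  fisub_at :> forall n, submod (V n);
  fisub_map : forall m n (f : inj_ord m n) (x : V m),
    x \in fisub_at m -> fi_map f x \in fisub_at n }.

Section SubQuotient.
Variables (k : comNzRingType) (V : fimod k) (S : fisub V).

Definition fi_sub : fimod k.
Proof.
apply: (@FIMod k (fun n => subm (S n) : lmodType k)
  (fun m n f => subm_map (@fisub_map _ _ S m n f))).
- move=> m n f; exact/subm_map_linear/fi_map_linear.
- by move=> m x; apply/val_inj; rewrite /= fi_map_id.
- by move=> m n p g f x; apply/val_inj; rewrite /= fi_map_comp.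
Defined.

Definition fi_quot : fimod k.
Proof.
apply: (@FIMod k (fun n => quotm (S n) : lmodType k)
  (fun m n f => @quotm_map k (V m) (V n) (S m) (S n) (fi_map f))).
- move=> m n f; apply: quotm_map_linear; first exact: fi_map_linear.
  exact: fisub_map.
- by move=> m x; rewrite /quotm_map fi_map_id quotm_reprK.
- move=> m n p g f; elim/quotm_ind=> x.
  rewrite !quotm_map_pi ?fi_map_comp //; try exact: fi_map_linear.
  all: exact: fisub_map.
Defined.

End SubQuotient.

Section GeneratedFISub.
Variables (k : comNzRingType) (V : fimod k) (G : forall n, set (V n)).

Definition fi_gen_pred n : {pred V n} :=
  [pred x : V n |
    `[< forall S : fisub V, (forall m y, @G m y -> y \in S m) -> x \in S n >]].

Lemma fi_gen_pred_closed n : submod_closed (@fi_gen_pred n).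
Proof.
split=> [|a x y /asboolP hx /asboolP hy]; apply/asboolP => S hS.
  exact: rpred0.
by apply: rpredD; [apply: rpredZ; apply: hx | apply: hy].
Qed.

Definition fi_gen : fisub V.
Proof.
apply: (@FISub k V (fun n => Submod (fi_gen_pred_closed n))).
move=> m n f x /asboolP hx; apply/asboolP => S hS.
exact/fisub_map/hx.
Defined.

End GeneratedFISub.

Section Filtration.
Variables (k : comNzRingType) (V : fimod k).

(* The submodule of V generated by the V_j with j < i; thus
   V^i = filt_lt i.+1 and V^{i-1} = filt_lt i, with V^{-1} = filt_lt 0 = 0. *)
Definition filt_lt (i : nat) : fisub V :=
  fi_gen (fun m => [set _ : V m | (m < i)%N]).

Definition filt (i : nat) : fimod k := fi_sub (filt_lt i.+1).

Section Pred.
Variable i : nat.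

Definition filt_pred_pred m : {pred filt i m} :=
  [pred x : filt i m | val (x : subm (filt_lt i.+1 m)) \in filt_lt i m].

Lemma filt_pred_closed m : submod_closed (@filt_pred_pred m).
Proof.
split=> [|a x y hx hy]; first exact: (rpred0 (filt_lt i m)).
exact: (rpredD (rpredZ a hx : a *: val x \in in_submod (filt_lt i m)) hy).
Qed.

(* V^{i-1} as a submodule of V^i *)
Definition filt_pred : fisub (filt i).
Proof.
apply: (@FISub k (filt i) (fun m => Submod (filt_pred_closed m))).
by move=> m n f x; apply: fisub_map.
Defined.

End Pred.

(* V^i / V^{i-1} *)
Definition gr (i : nat) : fimod k := fi_quot (filt_pred i).

(* sum_(j < i) C(j, i) V_j, and H_0(V)_i *)
Definition decomp (i : nat) : submod (V i) :=
  gen_submod [set x : V i | exists j (f : inj_ord j i) (y : V j),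
    (j < i)%N /\ x = fi_map f y].

Definition H0 (i : nat) : lmodType k := quotm (decomp i).

Definition gd : \bar int :=
  supremum -oo%E [set ext_nat i | i in [set i | exists x : H0 i, x <> 0]].

End Filtration.

Section Push.
Variables (k : comNzRingType) (M : lmodType k).

Definition push (X Y : finType) (u : X -> Y) (a : {ffun X -> M}) :
  {ffun Y -> M} := [ffun y => \sum_(x | u x == y) a x].

Lemma push_linear (X Y : finType) (u : X -> Y) : linear (push u).
Proof.
move=> c a b; apply/ffunP => y; rewrite !ffunE scaler_sumr -big_split /=.
by apply: eq_bigr => x _; rewrite !ffunE.
Qed.

Lemma push_id (X : finType) (u : X -> X) a : u =1 id -> push u a = a.
Proof.
move=> uid; apply/ffunP => y; rewrite ffunE (big_pred1 y) // => x.
by rewrite uid.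
Qed.

Lemma push_comp (X Y Z : finType) (v : Y -> Z) (u : X -> Y) w a :
  (forall x, w x = v (u x)) -> push w a = push v (push u a).
Proof.
move=> wE; apply/ffunP => z; rewrite !ffunE.
rewrite (partition_big u (fun y => v y == z)) /= => [|x]; last by rewrite wE.
apply: eq_bigr => y /eqP vy; rewrite ffunE; apply: eq_bigl => x.
by rewrite wE andbC; case: eqP => // ->; rewrite vy eqxx.
Qed.

End Push.

Section FinGen.
Variable k : comNzRingType.

(* underline C(i, -); {ffun X -> k} is the free module on the finite set X *)
Definition fi_rep (i : nat) : fimod k.
Proof.
apply: (@FIMod k (fun m => {ffun inj_ord i m -> k^o} : lmodType k)
  (fun m n g => push (inj_ord_comp g))).
- by move=> m n g; apply: push_linear.
- by move=> m x; apply: push_id => f; rewrite inj_ord_comp1l.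
- by move=> m n p g f x; apply: push_comp => h; rewrite inj_ord_compA.
Defined.

Definition fi_zero : fimod k.
Proof.
apply: (@FIMod k (fun m => 'rV[k]_0 : lmodType k) (fun m n g => id)) => //.
Defined.

Definition fi_dsum (V W : fimod k) : fimod k.
Proof.
apply: (@FIMod k (fun m => (V m * W m)%type : lmodType k)
  (fun m n g x => (fi_map g x.1, fi_map g x.2))).
- by move=> m n g a x y; rewrite /= !linearP.
- by move=> m [x y]; rewrite /= !fi_map_id.
- by move=> m n p g f x; rewrite /= !fi_map_comp.
Defined.

Definition fi_fin_gen (V : fimod k) : Prop :=
  exists (s : seq nat) (f : fihom (foldr (fi_dsum \o fi_rep) fi_zero s) V),
    fi_surj f.

End FinGen.

(* The group algebra is taken to be the endomorphism algebra of i in the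
   linearization of C, with composition as product.  The group structure of
   'S_i in perm.v composes in the opposite order. *)
Definition grpalg (k : comNzRingType) (i : nat) : Type := {ffun inj_ord i i -> k^o}.

Section GroupAlgebra.
Variables (k : comNzRingType) (i : nat).
Local Notation A := (grpalg k i).

HB.instance Definition _ := GRing.Lmodule.on A.

Implicit Types a b c : A.

Definition ga_delta (s : inj_ord i i) : A := [ffun h => (h == s)%:R].

Definition ga_one : A := ga_delta (inj_ord_id i).

Definition ga_mul a b : A :=
  [ffun h => \sum_(p | inj_ord_comp p.1 p.2 == h) (a p.1 * b p.2)].

Lemma ga_mul_sum (M : lmodType k) (F : inj_ord i i -> M) a b :
  \sum_h ga_mul a b h *: F h =
  \sum_f \sum_g (a f * b g) *: F (inj_ord_comp f g).
Proof.
rewrite pair_bigA /= (partition_big (fun p => inj_ord_comp p.1 p.2) predT) //=.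
apply: eq_bigr => h _; rewrite ffunE scaler_suml.
by apply: eq_bigr => p /eqP ->.
Qed.

Lemma ga_delta_sum (M : lmodType k) (F : inj_ord i i -> M) s :
  \sum_h ga_delta s h *: F h = F s.
Proof.
rewrite (bigD1 s) //= big1 ?addr0 ?ffunE ?eqxx ?scale1r // => h /negPf hs.
by rewrite ffunE hs scale0r.
Qed.

Lemma ga_coef a h : a h = \sum_g a g *: ((g == h)%:R : k^o).
Proof.
rewrite (bigD1 h) //= big1 ?addr0 ?eqxx /GRing.scale /= ?mulr1 // => g /negPf ->.
by rewrite mulr0.
Qed.

Lemma ga_ext a b : (forall (M : lmodType k) (F : inj_ord i i -> M),
  \sum_h a h *: F h = \sum_h b h *: F h) -> a = b.
Proof. by move=> h; apply/ffunP => x; rewrite ga_coef h -ga_coef. Qed.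

Fact ga_mulA : associative ga_mul.
Proof.
move=> a b c; apply: ga_ext => M F.
rewrite [LHS]ga_mul_sum [RHS]ga_mul_sum.
transitivity (\sum_f \sum_g \sum_h (a f * b g * c h) *:
  F (inj_ord_comp (inj_ord_comp f g) h)).
  apply: eq_bigr => f _.
  under eq_bigr do rewrite -scalerA; rewrite -scaler_sumr ga_mul_sum.
  rewrite scaler_sumr; apply: eq_bigr => g _; rewrite scaler_sumr.
  by apply: eq_bigr => h _; rewrite scalerA mulrA inj_ord_compA.
rewrite [RHS]exchange_big /=.
under eq_bigr do rewrite exchange_big /=.
rewrite exchange_big; apply: eq_bigr => h _.
under [RHS]eq_bigr do rewrite mulrC -scalerA.
rewrite -scaler_sumr ga_mul_sum scaler_sumr; apply: eq_bigr => f _.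
by rewrite scaler_sumr; apply: eq_bigr => g _; rewrite scalerA mulrC.
Qed.

Fact ga_mul1 : left_id ga_one ga_mul.
Proof.
move=> a; apply: ga_ext => M F; rewrite ga_mul_sum.
under eq_bigr do under eq_bigr do rewrite -scalerA.
under eq_bigr do rewrite -scaler_sumr.
by rewrite ga_delta_sum; apply: eq_bigr => h _; rewrite inj_ord_comp1l.
Qed.

Fact ga_mulr1 : right_id ga_one ga_mul.
Proof.
move=> a; apply: ga_ext => M F; rewrite ga_mul_sum exchange_big /=.
under eq_bigr do under eq_bigr do rewrite mulrC -scalerA.
under eq_bigr do rewrite -scaler_sumr.
by rewrite ga_delta_sum; apply: eq_bigr => h _; rewrite inj_ord_comp1r.
Qed.

Fact ga_mulDl : left_distributive ga_mul +%R.
Proof.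
move=> a b c; apply/ffunP => h; rewrite !ffunE -big_split.
by apply: eq_bigr => p _; rewrite !ffunE mulrDl.
Qed.
Fact ga_mulDr : right_distributive ga_mul +%R.
Proof.
move=> a b c; apply/ffunP => h; rewrite !ffunE -big_split.
by apply: eq_bigr => p _; rewrite !ffunE mulrDr.
Qed.

Fact ga_one_neq0 : ga_one != 0.
Proof.
by apply/eqP => /ffunP/(_ (inj_ord_id i))/eqP; rewrite !ffunE eqxx oner_eq0.
Qed.

HB.instance Definition _ := GRing.Zmodule_isNzRing.Build A
  ga_mulA ga_mul1 ga_mulr1 ga_mulDl ga_mulDr ga_one_neq0.

Fact ga_scaleAl (c : k) a b : c *: (a * b) = (c *: a) * b.
Proof.
apply/ffunP => h; rewrite !ffunE scaler_sumr.
by apply: eq_bigr => p _; rewrite !ffunE -scalerAl.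
Qed.
Fact ga_scaleAr (c : k) a b : c *: (a * b) = a * (c *: b).
Proof.
apply/ffunP => h; rewrite !ffunE scaler_sumr.
by apply: eq_bigr => p _; rewrite !ffunE -scalerAr.
Qed.

HB.instance Definition _ := GRing.Lmodule_isLalgebra.Build k A ga_scaleAl.
HB.instance Definition _ := GRing.Lalgebra_isAlgebra.Build k A ga_scaleAr.

End GroupAlgebra.

Definition fi_at (k : comNzRingType) (V : fimod k) (i : nat) : Type := V i.

Section FIAt.
Variables (k : comNzRingType) (V : fimod k) (i : nat).
Local Notation T := (fi_at V i).

HB.instance Definition _ := GRing.Zmodule.on T.

Definition fi_at_scale (a : grpalg k i) (x : T) : T :=
  \sum_s a s *: fi_map s (x : V i).

Fact fi_at_scaleA a b x :
  fi_at_scale a (fi_at_scale b x) = fi_at_scale (a * b) x.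
Proof.
rewrite /fi_at_scale ga_mul_sum; apply: eq_bigr => f _.
rewrite linear_sum scaler_sumr; apply: eq_bigr => g _.
by rewrite linearZ /= scalerA fi_map_comp.
Qed.
Fact fi_at_scale1 : left_id 1 fi_at_scale.
Proof. by move=> x; rewrite /fi_at_scale ga_delta_sum fi_map_id. Qed.
Fact fi_at_scaleDr : right_distributive fi_at_scale +%R.
Proof.
move=> a x y; rewrite /fi_at_scale -big_split /=.
by apply: eq_bigr => f _; rewrite linearD scalerDr.
Qed.
Fact fi_at_scaleDl x : {morph fi_at_scale^~ x : a b / a + b}.
Proof.
move=> a b; rewrite /fi_at_scale -big_split /=.
by apply: eq_bigr => f _; rewrite ffunE scalerDl.
Qed.

HB.instance Definition _ := GRing.Zmodule_isLmodule.Build (grpalg k i) T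
  fi_at_scaleA fi_at_scale1 fi_at_scaleDr fi_at_scaleDl.

End FIAt.

Definition restr (k : comNzRingType) (A : algType k) (T : lmodType A) : Type := T.

Section Restriction.
Variables (k : comNzRingType) (A : algType k) (T : lmodType A).

HB.instance Definition _ := GRing.Zmodule.on (restr T).

Definition restr_scale (c : k) (x : restr T) : restr T := c%:A *: (x : T).

Fact restr_scaleA a b x : restr_scale a (restr_scale b x) = restr_scale (a * b) x.
Proof. by rewrite /restr_scale scalerA mulr_algl scalerA. Qed.
Fact restr_scale1 : left_id 1 restr_scale.
Proof. by move=> x; rewrite /restr_scale !scale1r. Qed.
Fact restr_scaleDr : right_distributive restr_scale +%R.
Proof. by move=> a x y; rewrite /restr_scale scalerDr. Qed.
Fact restr_scaleDl x : {morph restr_scale^~ x : a b / a + b}.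
Proof. by move=> a b; rewrite /restr_scale !scalerDl. Qed.

HB.instance Definition _ := GRing.Zmodule_isLmodule.Build k (restr T)
  restr_scaleA restr_scale1 restr_scaleDr restr_scaleDl.

End Restriction.

Section Induction.
Variables (k : comNzRingType) (i : nat) (T : lmodType (grpalg k i)).

(* As underline C(i, m) is k-free on C(i, m), the k-module
   underline C(i, m) (x)_k T is {ffun inj_ord i m -> T}, and f (x) t is the function
   with value t at f and 0 elsewhere.  Dividing by the elements
   fs (x) t - f (x) st, for s in S_i, gives underline C(i, m) (x)_{k S_i} T. *)
Definition ptens m (f : inj_ord i m) (t : restr T) : {ffun inj_ord i m -> restr T} :=
  [ffun h => if h == f then t else 0].

Definition tens_rel m : submod {ffun inj_ord i m -> restr T} :=
  gen_submod [set x : {ffun inj_ord i m -> restr T} |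
    exists (f : inj_ord i m) (s : inj_ord i i) (t : T),
      x = ptens (inj_ord_comp f s) t - ptens f (ga_delta k s *: t)].

Lemma push_ptens m n (g : inj_ord m n) (f : inj_ord i m) t :
  push (inj_ord_comp g) (ptens f t) = ptens (inj_ord_comp g f) t.
Proof.
apply/ffunP => h; rewrite !ffunE.
under eq_bigr do rewrite ffunE; rewrite -big_mkcondr /=.
have [->|hne] := eqVneq h (inj_ord_comp g f).
  by rewrite (big_pred1 f) // => x /=; rewrite andbC; case: eqP => // ->; rewrite eqxx.
by rewrite big1 // => x /andP[/eqP gx /eqP xf]; rewrite -gx xf eqxx in hne.
Qed.

Lemma tens_rel_map m n (g : inj_ord m n) x :
  x \in tens_rel m -> push (inj_ord_comp g) x \in tens_rel n.
Proof.
have cl : submod_closed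
    [pred x : {ffun inj_ord i m -> restr T} | push (inj_ord_comp g) x \in tens_rel n].
  split=> [|a y z hy hz].
    rewrite -[0](subrr 0) unfold_in (linB (push_linear _)) subrr.
    exact: (rpred0 (tens_rel n)).
  rewrite unfold_in /= push_linear.
  exact: (rpredD (rpredZ a hy : _ \in in_submod (tens_rel n)) hz).
move/asboolP/(_ (Submod cl)); apply=> y [f [s [t ->]]].
rewrite unfold_in /= (linB (push_linear _)) !push_ptens; apply/asboolP => S; apply.
by exists (inj_ord_comp g f), s, t; rewrite inj_ord_compA.
Qed.

(* underline C (x)_{k S_i} T *)
Definition ind : fimod k.
Proof.
apply: (@FIMod k (fun m => quotm (tens_rel m) : lmodType k)
  (fun m n g => @quotm_map k _ _ (tens_rel m) (tens_rel n) (push (inj_ord_comp g)))).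
- move=> m n g; apply: quotm_map_linear; first exact: push_linear.
  exact: tens_rel_map.
- move=> m x; rewrite /quotm_map push_id ?quotm_reprK // => f.
  exact: inj_ord_comp1l.
- move=> m n p g f; elim/quotm_ind=> x.
  rewrite !quotm_map_pi; try exact: push_linear; try exact: tens_rel_map.
  by congr quotm_pi; apply: push_comp => h; rewrite inj_ord_compA.
Defined.

End Induction.

(* Main.v *)
(* For S inside [n] let V_S be the image in V_n of the value of V at S.  Call V
   distributive if its maps are injective and V_S meets a sum of V_T's in the
   sum of the V_(S :&: T)'s.  Retracts of sums of C(j, -) (x) T, in particular
   projectives, are distributive.  An inclusion of a distributive U in W is pure:
   an element of U_n lying in a sum of W_T's lies in the sum of the U_T's, as one
   sees by moving the complement of one T to a disjoint copy.  Purity makes the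
   cokernel of U -> W distributive when W is, and makes H_0 exact on such
   sequences.  Climbing up a finite projective resolution, V is distributive, so
   each V^i/V^(i-1) is induced from H_0(V)_i; and H_0(-)_i, which preserves
   projectives, sends the resolution to one of the same length over kS_i.
   Conversely induction from S_i is exact and preserves projectives, and the
   horseshoe lemma along the filtration bounds pd(V).  Finally a kS_i-module of
   finite projective dimension that is k-projective is kS_i-projective, since by
   Higman's trace criterion k-split inclusions of projectives split over kS_i; so
   the dimensions over kS_i and over k agree. *)
Require Import Defs.
From HB Require Import structures.
From mathcomp Require Import all_boot all_order all_algebra.
From mathcomp Require Import boolp classical_sets.
From mathcomp Require Import constructive_ereal.

Set Implicit Arguments.
Unset Strict Implicit.
Unset Printing Implicit Defensive.

Import Order.TTheory GRing.Theory Num.Theory.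

Local Open Scope ring_scope.

(** * Homological dimension *)

(** [H_0] is only right exact, and nothing is known in advance about the syzygies of V. The one
    thing that can be carried along a resolution is a property passing from K and P to P/K, and the
    finite length supplies a projective K to start from. Distributivity is such a property, stated
    in elements, so that no derived functor has to be introduced. All dimensions are handled one
    bound d at a time: pd(V) <= d exactly when every V^i/V^(i-1) is induced and its value at i has
    dimension at most d over kS_i. The finiteness criterion and the formula for pd(V) are both read
    off from this equivalence for varying d. Projectives are preserved each time for the same
    reason, namely that the functor is left adjoint to one preserving surjections. The pairs are
    H_0(-)_i with concentration in degree i, induction with evaluation at i, and restriction to k
    with coinduction. The same diagram chases are needed for FI-modules, kS_i-modules and k-modules,
    hence an abstract setting with elements. *)

(* The part of the structure of an abelian category of (families of) modules
   that homological dimension needs; the elements of an object are sorted by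
   So, which is nat for FI-modules and unit for modules over a ring. *)
Record acat := ACat {
  Ob : Type;
  So : Type;
  el : Ob -> So -> zmodType;
  Hom : Ob -> Ob -> Type;
  ap : forall A B, Hom A B -> forall s, el A s -> el B s;
  apB : forall A B (f : Hom A B) s, {morph ap f (s := s) : x y / x - y};
  cid : forall A, Hom A A;
  cidE : forall A s (x : el A s), ap (cid A) x = x;
  ccomp : forall A B C, Hom B C -> Hom A B -> Hom A C;
  ccompE : forall A B C (g : Hom B C) (f : Hom A B) s (x : el A s),
    ap (ccomp g f) x = ap g (ap f x);
  csub : forall A B, Hom A B -> Hom A B -> Hom A B;
  csubE : forall A B (f g : Hom A B) s (x : el A s),
    ap (csub f g) x = ap f x - ap g x;
  cker : forall A B, Hom A B -> Ob;
  ckinc : forall A B (f : Hom A B), Hom (cker f) A;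
  ckinc_inj : forall A B (f : Hom A B) s, injective (@ap _ _ (ckinc f) s);
  ckincP : forall A B (f : Hom A B) s (x : el A s),
    ap f x = 0 <-> exists y, ap (ckinc f) y = x;
  mono_lift : forall K P X (i : Hom K P) (f : Hom X P),
    (forall s, injective (@ap _ _ i s)) ->
    (forall s (x : el X s), exists y, ap i y = ap f x) ->
    exists g : Hom X K, forall s (x : el X s), ap i (ap g x) = ap f x;
  csum : Ob -> Ob -> Ob;
  cin1 : forall A B, Hom A (csum A B);
  cin2 : forall A B, Hom B (csum A B);
  cpr1 : forall A B, Hom (csum A B) A;
  cpr2 : forall A B, Hom (csum A B) B;
  cpr1in1 : forall A B s (x : el A s), ap (cpr1 A B) (ap (cin1 A B) x) = x;
  cpr2in2 : forall A B s (x : el B s), ap (cpr2 A B) (ap (cin2 A B) x) = x;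
  cpr1in2 : forall A B s (x : el B s), ap (cpr1 A B) (ap (cin2 A B) x) = 0;
  cpr2in1 : forall A B s (x : el A s), ap (cpr2 A B) (ap (cin1 A B) x) = 0;
  cin12 : forall A B s (x : el (csum A B) s),
    x = ap (cin1 A B) (ap (cpr1 A B) x) + ap (cin2 A B) (ap (cpr2 A B) x) }.

Arguments cin1 {a} A B.
Arguments cin2 {a} A B.
Arguments cpr1 {a} A B.
Arguments cpr2 {a} A B.

Section Homological.
Variable C : acat.
Implicit Types A B K L M N P Q V : Ob C.

Definition surj A B (f : Hom A B) := forall s, surjective (@ap C _ _ f s).
Definition inj A B (f : Hom A B) := forall s, injective (@ap C _ _ f s).
Definition proj P := forall M N (g : Hom M N) (f : Hom P N), surj g ->
  exists h : Hom P M, forall s (x : el P s), ap g (ap h x) = ap f x.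
Definition exact_at A B V (i : Hom A B) (e : Hom B V) :=
  forall s (x : el B s), ap e x = 0 <-> exists y, ap i y = x.
Definition ses A B V (i : Hom A B) (e : Hom B V) :=
  [/\ inj i, exact_at i e & surj e].

(** Recursion on syzygies is the form suited to induction on the length; [has_resP] matches it with
    resolutions. *)
Fixpoint pd_le d V : Prop :=
  if d is d'.+1 then exists K P (i : Hom K P) (e : Hom P V),
    [/\ ses i e, proj P & pd_le d' K]
  else proj V.

Definition has_res V (n : nat) : Prop :=
  exists (P : nat -> Ob C) (d : forall i, Hom (P i.+1) (P i)) (e : Hom (P 0) V),
    [/\ forall i, proj (P i),
        forall i, (n < i)%N -> forall s (x : el (P i) s), x = 0,
        surj e,
        exact_at (d 0) e
      & forall i, exact_at (d i.+1) (d i)].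

Lemma ap0 A B (f : Hom A B) s : ap f (0 : el A s) = 0.
Proof. by rewrite -[X in ap f X](subrr 0) apB subrr. Qed.

Lemma apN A B (f : Hom A B) s (x : el A s) : ap f (- x) = - ap f x.
Proof. by rewrite -[- x]add0r apB ap0 add0r. Qed.

Lemma apD A B (f : Hom A B) s (x y : el A s) : ap f (x + y) = ap f x + ap f y.
Proof. by rewrite -[y in LHS]opprK apB apN opprK. Qed.

Lemma injP A B (f : Hom A B) : (forall s (x : el A s), ap f x = 0 -> x = 0) -> inj f.
Proof.
move=> h s x y /eqP; rewrite -subr_eq0 -apB => /eqP/h/eqP.
by rewrite subr_eq0 => /eqP.
Qed.

Lemma ses_ker A B (e : Hom A B) : surj e -> ses (ckinc e) e.
Proof. by split=> //; [apply: ckinc_inj | move=> s x; apply: ckincP]. Qed.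

Lemma ses_comp0 A B V (i : Hom A B) (e : Hom B V) s (x : el A s) :
  exact_at i e -> ap e (ap i x) = 0.
Proof. by move=> h; apply/h; exists x. Qed.

(** Subtraction is the only operation on morphisms in [acat], so a sum f + g is written f - ((g - g)
    - g). *)
Definition ccopair A B V (f : Hom A V) (g : Hom B V) : Hom (csum A B) V :=
  csub (ccomp f (cpr1 A B)) (csub (csub (ccomp g (cpr2 A B)) (ccomp g (cpr2 A B)))
    (ccomp g (cpr2 A B))).

Lemma ccopairE A B V (f : Hom A V) (g : Hom B V) s (x : el (csum A B) s) :
  ap (ccopair f g) x = ap f (ap (cpr1 A B) x) + ap g (ap (cpr2 A B) x).
Proof. by rewrite !csubE !ccompE subrr sub0r opprK. Qed.

Lemma ccopair1 A B V (f : Hom A V) (g : Hom B V) s (x : el A s) :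
  ap (ccopair f g) (ap (cin1 A B) x) = ap f x.
Proof. by rewrite ccopairE cpr1in1 cpr2in1 ap0 addr0. Qed.

Lemma ccopair2 A B V (f : Hom A V) (g : Hom B V) s (x : el B s) :
  ap (ccopair f g) (ap (cin2 A B) x) = ap g x.
Proof. by rewrite ccopairE cpr1in2 cpr2in2 ap0 add0r. Qed.

Definition cpair A B V (f : Hom V A) (g : Hom V B) : Hom V (csum A B) :=
  csub (ccomp (cin1 A B) f) (csub (csub (ccomp (cin2 A B) g) (ccomp (cin2 A B) g))
    (ccomp (cin2 A B) g)).

Lemma cpairE A B V (f : Hom V A) (g : Hom V B) s (x : el V s) :
  ap (cpair f g) x = ap (cin1 A B) (ap f x) + ap (cin2 A B) (ap g x).
Proof. by rewrite !csubE !ccompE subrr sub0r opprK. Qed.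

Lemma cpair1 A B V (f : Hom V A) (g : Hom V B) s (x : el V s) :
  ap (cpr1 A B) (ap (cpair f g) x) = ap f x.
Proof. by rewrite cpairE apD cpr1in1 cpr1in2 addr0. Qed.

Lemma cpair2 A B V (f : Hom V A) (g : Hom V B) s (x : el V s) :
  ap (cpr2 A B) (ap (cpair f g) x) = ap g x.
Proof. by rewrite cpairE apD cpr2in1 cpr2in2 add0r. Qed.

Lemma csum_ext A B s (x y : el (csum A B) s) :
  ap (cpr1 A B) x = ap (cpr1 A B) y -> ap (cpr2 A B) x = ap (cpr2 A B) y -> x = y.
Proof. by move=> h1 h2; rewrite (cin12 x) h1 h2 -cin12. Qed.

Lemma proj_retract P Q (s : Hom P Q) (r : Hom Q P) :
  (forall t (x : el P t), ap r (ap s x) = x) -> proj Q -> proj P.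
Proof.
move=> rs hQ M N g f gs; have [h hE] := hQ _ _ g (ccomp f r) gs.
by exists (ccomp h s) => t x; rewrite ccompE hE ccompE rs.
Qed.

Lemma proj_csum P Q : proj P -> proj Q -> proj (csum P Q).
Proof.
move=> hP hQ M N g f gs.
have [h1 h1E] := hP _ _ g (ccomp f (cin1 P Q)) gs.
have [h2 h2E] := hQ _ _ g (ccomp f (cin2 P Q)) gs.
exists (ccopair h1 h2) => s x.
by rewrite ccopairE apD h1E h2E !ccompE -apD -cin12.
Qed.

Lemma proj_section P M (g : Hom M P) : proj P -> surj g ->
  exists h : Hom P M, forall s (x : el P s), ap g (ap h x) = x.
Proof.
move=> hP gs; have [h hE] := hP _ _ g (cid P) gs.
by exists h => s x; rewrite hE cidE.
Qed.

(** For a section h of e, the map id - h e lands in the image of i; lifting it through i gives the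
    retraction. *)
Lemma ses_retraction A B P (i : Hom A B) (e : Hom B P) : ses i e -> proj P ->
  exists (h : Hom P B) (r : Hom B A),
    [/\ forall s (x : el P s), ap e (ap h x) = x,
        forall s (x : el A s), ap r (ap i x) = x
      & forall s (x : el B s), x = ap i (ap r x) + ap h (ap e x)].
Proof.
move=> [ii ie es] hP; have [h hE] := proj_section hP es.
have [s x|r rE] := mono_lift (f := csub (cid B) (ccomp h e)) ii.
  by apply/ie; rewrite csubE cidE ccompE apB hE subrr.
exists h, r; split=> // s x; last by rewrite rE csubE cidE ccompE subrK.
by apply: ii; rewrite rE csubE cidE ccompE (ses_comp0 _ ie) ap0 subr0.
Qed.

Lemma pd_le_iso d V W (f : Hom V W) : inj f -> surj f -> pd_le d V -> pd_le d W.
Proof.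
move=> fi fs; case: d => [|d] /= => [hV|[K [P [i [e [[ii ie es] hP hK]]]]]].
  have [s x|g gE] := mono_lift (f := cid W) fi.
    by have [y <-] := fs s x; exists y; rewrite cidE.
  by apply: (@proj_retract W V g f) hV => t x; rewrite gE cidE.
exists K, P, i, (ccomp f e); split=> //; split=> // [s x|s x].
  rewrite ccompE -ie; split=> [h|->]; last exact: ap0.
  by apply: fi; rewrite h ap0.
by have [y <-] := fs s x; have [z <-] := es s y; exists z; rewrite ccompE.
Qed.

Lemma pd_le_iso_inv d V W (f : Hom V W) : inj f -> surj f -> pd_le d W -> pd_le d V.
Proof.
move=> fi fs; have [s x|g gE] := mono_lift (f := cid W) fi.
  by have [y <-] := fs s x; exists y; rewrite cidE.
apply: (@pd_le_iso d W V g) => [s x y xy|s x].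
  by rewrite -[x]cidE -[y]cidE -!gE xy.
by exists (ap f x); apply: fi; rewrite gE cidE.
Qed.

Lemma ses_csum P A B V (i : Hom A B) (e : Hom B V) : ses i e ->
  ses (ccomp (cin2 P B) i) (cpair (cpr1 P B) (ccomp e (cpr2 P B))).
Proof.
move=> [ii ie es]; split.
- apply: injP => s x /(congr1 (fun z => ap (cpr2 P B) z)).
  by rewrite ccompE cpr2in2 ap0 => h; apply: ii; rewrite ap0.
- move=> s x; split=> [h|[y <-]].
    have h1 := congr1 (fun z => ap (cpr1 P V) z) h.
    have /ie[y hy] : ap e (ap (cpr2 P B) x) = 0.
      by have := congr1 (fun z => ap (cpr2 P V) z) h; rewrite cpair2 ccompE ap0.
    exists y; rewrite ccompE; apply: csum_ext; last by rewrite cpr2in2.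
    by move: h1; rewrite cpr1in2 cpair1 ap0.
  apply: csum_ext; rewrite ap0 ccompE ?cpair1 ?cpair2 ?cpr1in2 //.
  by rewrite ccompE cpr2in2 ses_comp0.
- move=> s x; have [y hy] := es s (ap (cpr2 P V) x).
  exists (ap (cin1 P B) (ap (cpr1 P V) x) + ap (cin2 P B) y).
  apply: csum_ext; rewrite ?cpair1 ?cpair2 ?ccompE !apD.
    by rewrite cpr1in1 cpr1in2 addr0.
  by rewrite cpr2in1 cpr2in2 ap0 add0r.
Qed.

Lemma pd_le_csum d P V : proj P -> pd_le d V -> pd_le d (csum P V).
Proof.
move=> hP; case: d => [|d] /= => [|[K [Q [i [e [h hQ hK]]]]]].
  exact: proj_csum.
exists K, (csum P Q), (ccomp (cin2 P Q) i),
  (cpair (cpr1 P Q) (ccomp e (cpr2 P Q))).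
split=> //; first exact: ses_csum h.
exact: proj_csum.
Qed.

(** If R covers M with syzygy L, the kernel of R -> M -> Q is a summand of R because Q is
    projective, and it covers K with the same syzygy L. *)
Lemma pd_le_kernel_proj d K M Q (i : Hom K M) (e : Hom M Q) :
  ses i e -> proj Q -> pd_le d M -> pd_le d K.
Proof.
move=> h hQ; case: d => [|d] /= => [hM|[L [R [j [p [[ji jp ps] hR hL]]]]]].
  have [_ [r [_ rK _]]] := ses_retraction h hQ; exact: proj_retract rK hM.
have [ii ie es] := h.
have ps' : surj (ccomp e p).
  move=> s x; have [y <-] := es s x; have [z <-] := ps s y.
  by exists z; rewrite ccompE.
have kses := ses_ker ps'; have [ki ke _] := kses.
have [s x|q qE] := mono_lift (f := ccomp p (ckinc (ccomp e p))) ii.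
  by apply/ie; rewrite ccompE -ccompE ses_comp0.
have [s x|l lE] := mono_lift (f := j) ki.
  by apply/ke; rewrite ccompE (ses_comp0 _ jp) ap0.
exists L, (cker (ccomp e p)), l, q; split=> //; last first.
  have [_ [r [_ rK _]]] := ses_retraction kses hQ; exact: proj_retract rK hR.
split.
- apply: injP => s x x0; apply: ji; by rewrite ap0 -lE x0 ap0.
- move=> s x; split=> [x0|[y yx]].
    have /jp[y yE] : ap p (ap (ckinc (ccomp e p)) x) = 0 by rewrite -ccompE -qE x0 ap0.
    by exists y; apply: ki; rewrite lE.
  by apply: ii; rewrite qE ccompE -yx lE (ses_comp0 _ jp) ap0.
- move=> s x; have [y yE] := ps s (ap i x).
  have /ke[z zE] : ap (ccomp e p) y = 0 by rewrite ccompE yE ses_comp0.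
  by exists z; apply: ii; rewrite qE ccompE zE.
Qed.

(** Schanuel's lemma: a lift h : P -> P' of e restricts to r : K -> K', and 0 -> K -> P + K' -> P'
    -> 0 with maps (i, -r) and h + i' is exact. This frees the bound on a syzygy from the choice of
    the cover. *)
Lemma pd_le_syzygy d K P V (i : Hom K P) (e : Hom P V) :
  ses i e -> proj P -> pd_le d.+1 V -> pd_le d K.
Proof.
move=> [ii ie es] hP /= [K' [P' [i' [e' [[ii' ie' es'] hP' hK']]]]].
have [h hE] := hP _ _ e' e es'.
have [s x|r rE] := mono_lift (f := ccomp h i) ii'.
  by apply/ie'; rewrite ccompE hE ses_comp0.
apply: (@pd_le_kernel_proj d K (csum P K') P' (csub (ccomp (cin1 P K') i)
  (ccomp (cin2 P K') r)) (ccopair h i')) => //; last exact: pd_le_csum.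
split.
- apply: injP => s x /(congr1 (fun z => ap (cpr1 P K') z)).
  rewrite csubE !ccompE apB cpr1in1 cpr1in2 subr0 ap0 => x0.
  by apply: ii; rewrite x0 ap0.
- move=> s x; split=> [|[y <-]].
    rewrite ccopairE => /eqP; rewrite addr_eq0 => /eqP x0.
    have /ie[y yE] : ap e (ap (cpr1 P K') x) = 0.
      by rewrite -hE x0 apN (ses_comp0 _ ie') oppr0.
    exists y; apply: csum_ext; rewrite csubE !ccompE apB.
      by rewrite cpr1in1 cpr1in2 subr0.
    rewrite cpr2in1 cpr2in2 sub0r; apply: ii'.
    by rewrite apN rE ccompE yE x0 opprK.
  rewrite ccopairE csubE !ccompE !apB cpr1in1 cpr1in2 cpr2in1 cpr2in2.
  by rewrite !ap0 subr0 sub0r rE ccompE subrr.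
- move=> s x; have [y yE] := es s (ap e' x).
  have /ie'[z zE] : ap e' (x - ap h y) = 0 by rewrite apB hE yE subrr.
  exists (ap (cin1 P K') y + ap (cin2 P K') z).
  by rewrite apD ccopair1 ccopair2 zE addrC subrK.
Qed.

(** Horseshoe lemma: PA + PV covers B through i eA and a lift h of eV, and the three kernels again
    form a short exact sequence. *)
Lemma pd_le_ext d A B V (i : Hom A B) (e : Hom B V) :
  ses i e -> pd_le d A -> pd_le d V -> pd_le d B.
Proof.
elim: d A B V i e => [|d IH] A B V i e.
  move=> h hA hV /=; have [j [r [_ _ rE]]] := ses_retraction h hV.
  apply: (@proj_retract _ (csum A V) (cpair r e) (ccopair i j)).
    by move=> t x; rewrite ccopairE cpair1 cpair2 -rE.
  exact: proj_csum.
move=> [ii ie es] [KA [PA [iA [eA [[iiA ieA esA] hPA hKA]]]]].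
move=> [KV [PV [iV [eV [[iiV ieV esV] hPV hKV]]]]].
have [h hE] := hPV _ _ e eV es.
have qs : surj (ccopair (ccomp i eA) h).
  move=> s x; have [y yE] := esV s (ap e x).
  have /ie[z zE] : ap e (x - ap h y) = 0 by rewrite apB hE yE subrr.
  have [w wE] := esA s z.
  exists (ap (cin1 PA PV) w + ap (cin2 PA PV) y).
  by rewrite apD ccopair1 ccopair2 ccompE wE zE subrK.
have kses := ses_ker qs; have [ki ke _] := kses; set k := ckinc _ in ki ke kses.
exists (cker (ccopair (ccomp i eA) h)), (csum PA PV), k, (ccopair (ccomp i eA) h).
split=> //; first exact: proj_csum.
have [s x|a aE] := mono_lift (f := ccomp (cin1 PA PV) iA) ki.
  by apply/ke; rewrite ccompE ccopair1 ccompE (ses_comp0 _ ieA) ap0.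
have [s x|b bE] := mono_lift (f := ccomp (cpr2 PA PV) k) iiV.
  apply/ieV; rewrite ccompE.
  have : ap (ccopair (ccomp i eA) h) (ap k x) = 0 by apply: ses_comp0.
  rewrite ccopairE ccompE -hE => /(congr1 (fun z => ap e z)).
  by rewrite apD (ses_comp0 _ ie) add0r ap0.
apply: (IH _ _ _ a b _ hKA hKV); split.
- apply: injP => s x x0; have := aE s x; rewrite x0 ap0 ccompE.
  move/(congr1 (fun z => ap (cpr1 PA PV) z)); rewrite cpr1in1 ap0 => y0.
  by apply: iiA; rewrite ap0.
- move=> s x; split=> [x0|[y <-]]; last first.
    by apply: iiV; rewrite bE ccompE aE ccompE cpr2in1 ap0.
  have p0 : ap (cpr2 PA PV) (ap k x) = 0 by rewrite -ccompE -bE x0 ap0.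
  have : ap (ccopair (ccomp i eA) h) (ap k x) = 0 by apply: ses_comp0.
  rewrite ccopairE p0 ap0 addr0 ccompE => x1.
  have /ieA[y yE] : ap eA (ap (cpr1 PA PV) (ap k x)) = 0 by apply: ii; rewrite x1 ap0.
  exists y; apply: ki; rewrite aE ccompE; apply: csum_ext.
    by rewrite cpr1in1.
  by rewrite cpr2in1 p0.
- move=> s x; have /ie[z zE] : ap e (ap h (ap iV x)) = 0.
    by rewrite hE ses_comp0.
  have [w wE] := esA s z.
  have /ke[y yE] : ap (ccopair (ccomp i eA) h)
      (ap (cin2 PA PV) (ap iV x) - ap (cin1 PA PV) w) = 0.
    by rewrite apB ccopair1 ccopair2 ccompE wE zE subrr.
  exists y; apply: iiV; rewrite bE ccompE yE apB cpr2in2 cpr2in1.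
  by rewrite subr0.
Qed.

Lemma has_resP n V : has_res V n <-> pd_le n V.
Proof.
split.
  elim: n V => [|n IH] V [P [d [e [hP P0 es de dd]]]] /=.
    apply: (@pd_le_iso 0 _ _ e _ es (hP 0)); apply: injP => s x /de[y <-].
    by rewrite (P0 1 _ _ y) ?ap0.
  have [ki ke _] := ses_ker es.
  have [s x|q qE] := mono_lift (f := d 0) ki.
    by apply/ke/de; exists x.
  exists (cker e), (P 0), (ckinc e), e; split=> //; apply: IH.
  exists (fun i => P i.+1), (fun i => d i.+1), q; split=> // [i ni|s x|s x].
  - exact: P0.
  - have /de[y yE] : ap e (ap (ckinc e) x) = 0 by apply: ses_comp0 ke.
    by exists y; apply: ki; rewrite qE.
  - rewrite -dd; split=> [h|h]; first by rewrite -qE h ap0.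
    by apply: ki; rewrite qE h ap0.
elim: n V => [|n IH] V /=.
  (* The kernel of the identity serves as the zero object that pads the resolution. *)
  move=> hV; pose Z := cker (cid V).
  have Z0 s (x : el Z s) : x = 0.
    apply: (ckinc_inj (f := cid V)); rewrite ap0 -[LHS]cidE.
    by apply/ckincP; exists x.
  exists (fun i => if i is _.+1 then Z else V),
    (fun i => match i return Hom Z (if i is _.+1 then Z else V) with
       0 => ckinc (cid V) | _.+1 => cid Z end), (cid V).
  split.
  - case=> [|i] //; have [s x|z zE] := mono_lift
      (f := csub (cid V) (cid V)) (ckinc_inj (f := cid V)).
      by exists 0; rewrite csubE subrr ap0.
    apply: (@proj_retract Z V (ckinc (cid V)) z) => // t x.
    by rewrite (Z0 _ x) !ap0.
  - by case=> // i _ s x; apply: Z0.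
  - by move=> s x; exists x; rewrite cidE.
  - move=> s x; exact: ckincP.
  - case=> [|i] s x; split=> [h|[y _]].
    + by exists 0; rewrite (Z0 _ x) ap0.
    + by rewrite (Z0 _ x) ap0.
    + by exists 0; rewrite (Z0 _ x) ap0.
    + by rewrite (Z0 _ x) ap0.
move=> [K [Q [i [e [[ii ie es] hQ /IH[P [d [e' [hP P0 es' de' dd]]]]]]]]].
exists (fun j => if j is j'.+1 then P j' else Q),
  (fun j => match j return Hom (P j) (if j is j'.+1 then P j' else Q) with
    0 => ccomp i e' | j'.+1 => d j' end), e.
split=> //.
- by case.
- by case=> // j nj; apply: P0.
- move=> s x; rewrite ie; split=> [[y <-]|[y <-]].
    by have [z <-] := es' s y; exists z; rewrite ccompE.
  by exists (ap e' y); rewrite ccompE.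
- case=> [|j] //= s x; rewrite ccompE -de'; split=> [h|->]; last exact: ap0.
  by apply: ii; rewrite h ap0.
Qed.

Lemma pd_le_mono m n V : (m <= n)%N -> pd_le m V -> pd_le n V.
Proof.
move=> mn /has_resP[P [d [e [hP P0 es de dd]]]]; apply/has_resP.
by exists P, d, e; split=> // i ni; apply: P0; apply: leq_ltn_trans ni.
Qed.

End Homological.

(** * Modules and FI-modules as instances of the abstract setting *)

Definition mklin (R : pzRingType) (M N : lmodType R) (f : M -> N) (h : linear f) :
  {linear M -> N} :=
  HB.pack_for {linear M -> N} f (GRing.isLinear.Build R M N *:%R f h).

(** Injectivity of i makes every pointwise lift linear, so the axiom of choice alone supplies
    [mono_lift]. *)
Lemma mono_lift_fun (R : pzRingType) (K P X : lmodType R)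
    (i : K -> P) (f : X -> P) (g : X -> K) :
  linear i -> linear f -> injective i -> (forall x, i (g x) = f x) -> linear g.
Proof. by move=> il fl ii gE a x y; apply: ii; rewrite gE fl il !gE. Qed.

Section ModCat.
Variable R : pzRingType.
Implicit Types M N : lmodType R.

Definition lker_pred M N (f : {linear M -> N}) : {pred M} := [pred x | f x == 0].

Lemma lker_closed M N (f : {linear M -> N}) : submod_closed (lker_pred f).
Proof.
split=> [|a x y]; rewrite !inE ?linear0 // => /eqP fx /eqP fy.
by rewrite linearP fx fy scaler0 addr0.
Qed.

Definition lker M N (f : {linear M -> N}) : submod M := Submod (lker_closed f).

Lemma lkerP M N (f : {linear M -> N}) x : reflect (f x = 0) (x \in lker f).
Proof. exact: eqP. Qed.

Lemma id_linear M : linear (fun x : M => x).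
Proof. by []. Qed.

Lemma subm_val_linear M (S : submod M) : linear (fun x : subm S => val x).
Proof. by []. Qed.

Lemma lmod_mono_lift (K P X : lmodType R) (i : {linear K -> P}) (f : {linear X -> P}) :
  (forall s : unit, injective i) -> (forall (s : unit) (x : X), exists y, i y = f x) ->
  exists g : {linear X -> K}, forall (s : unit) x, i (g x) = f x.
Proof.
move=> /(_ tt) ii /(_ tt)/choice[g gE].
by exists (mklin (mono_lift_fun (linearP i) (linearP f) ii gE)).
Qed.

Lemma pair_linear (M N V : lmodType R) (f : {linear V -> M}) (g : {linear V -> N}) :
  linear (fun x => (f x, g x) : (M * N)%type).
Proof. by move=> a x y; rewrite !linearP. Qed.

Definition modcat : acat.
Proof.
refine (@ACat (lmodType R) unit (fun M _ => M : zmodType)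
  (fun M N => {linear M -> N}) (fun M N f s x => f x) _
  (fun M => mklin (@id_linear M)) _
  (fun M N P g f => [the {linear M -> P} of g \o f]) _
  (fun M N f g => [the {linear M -> N} of f \- g]) _
  (fun M N f => subm (lker f) : lmodType R)
  (fun M N f => mklin (@subm_val_linear M (lker f))) _ _ lmod_mono_lift
  (fun M N => (M * N)%type : lmodType R)
  (fun M N => mklin (pair_linear (mklin (@id_linear M)) \0))
  (fun M N => mklin (pair_linear \0 (mklin (@id_linear N))))
  (fun M N => [the {linear _ -> _} of fst]) (fun M N => [the {linear _ -> _} of snd])
  _ _ _ _ _) => //.
- by move=> M N f s x y; rewrite linearB.
- by move=> M N f s x y; apply: val_inj.
- move=> M N f s x; split=> [h|[y <-]]; last exact/lkerP/(valP y).
  by exists (exist _ x (introT (lkerP f x) h)).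
- by move=> M N s [x y] /=; congr pair; rewrite /= ?addr0 ?add0r.
Defined.

Lemma projectiveE M : projective M <-> @proj modcat M.
Proof.
split=> h P Q g f gs.
  by have [l lE] := h P Q g f (gs tt); exists l.
by have [|l lE] := h P Q g f; [case | exists l; apply: (lE tt)].
Qed.

Lemma proj_resE M n : proj_res M n <-> @has_res modcat M n.
Proof.
split=> -[P [d [e [h1 h2 h3 h4 h5]]]]; exists P, d, e.
  split=> [i|i ni s|s|s|i s]; first exact/projectiveE.
  - exact: h2.
  - exact: h3.
  - exact: h4.
  - exact: h5.
split=> [i|i ni|||i]; first exact/projectiveE.
- exact: (h2 i ni tt).
- exact: h3 tt.
- exact: h4 tt.
- exact: (h5 i tt).
Qed.

End ModCat.

Section FICat.
Variable k : comNzRingType.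
Implicit Types V W U : fimod k.

Definition fi_id V : fihom V V := @FIHom k V V (fun _ x => x)
  (fun _ _ _ _ => erefl) (fun _ _ _ _ => erefl).

Definition fi_comp U V W (g : fihom V W) (f : fihom U V) : fihom U W.
Proof.
apply: (@FIHom k U W (fun n x => g n (f n x))).
- by move=> n a x y; rewrite !linearP.
- by move=> m n h x; rewrite !fi_hom_nat.
Defined.

Definition fi_subh U V (g : fihom U V) (f : fihom U V) : fihom U V.
Proof.
apply: (@FIHom k U V (fun n x => g n x - f n x)).
- move=> n a x y; by rewrite !(fi_hom_linear _ n) scalerBr opprD addrACA.
- by move=> m n h x; rewrite !fi_hom_nat linearB.
Defined.

Definition fi_ker U V (f : fihom U V) : fisub U.
Proof.
apply: (@FISub k U (fun n => lker (f n))) => m n g x /lkerP /= fx; apply/lkerP.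
by rewrite /= fi_hom_nat fx linear0.
Defined.

Definition fi_inc V (S : fisub V) : fihom (fi_sub S) V.
Proof.
by apply: (@FIHom k (fi_sub S) V (fun n (x : subm (S n)) => val x)).
Defined.

Lemma fi_mono_lift (K P X : fimod k) (i : fihom K P) (f : fihom X P) :
  (forall n, injective (i n)) -> (forall n (x : X n), exists y, i n y = f n x) ->
  exists g : fihom X K, forall n x, i n (g n x) = f n x.
Proof.
move=> ii hf; pose g n := projT1 (choice (hf n)).
have gE n x : i n (g n x) = f n x := projT2 (choice (hf n)) x.
unshelve eexists.
  apply: (@FIHom k X K g) => [n|m n h x].
    exact: mono_lift_fun (fi_hom_linear i n) (fi_hom_linear f n) (ii n) (gE n).
  by apply: ii; rewrite gE !fi_hom_nat gE.
exact: gE.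
Qed.

Definition fi_in1 V W : fihom V (fi_dsum V W).
Proof.
apply: (@FIHom k V (fi_dsum V W) (fun n x => (x, 0))).
- by move=> n a x y; congr pair; rewrite /= scaler0 addr0.
- by move=> m n h x; rewrite /= linear0.
Defined.

Definition fi_in2 V W : fihom W (fi_dsum V W).
Proof.
apply: (@FIHom k W (fi_dsum V W) (fun n x => (0, x))).
- by move=> n a x y; congr pair; rewrite /= scaler0 addr0.
- by move=> m n h x; rewrite /= linear0.
Defined.

Definition fi_pr1 V W : fihom (fi_dsum V W) V.
Proof. by apply: (@FIHom k (fi_dsum V W) V (fun n x => x.1)). Defined.

Definition fi_pr2 V W : fihom (fi_dsum V W) W.
Proof. by apply: (@FIHom k (fi_dsum V W) W (fun n x => x.2)). Defined.

Definition ficat : acat.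
Proof.
refine (@ACat (fimod k) nat (fun V n => V n : zmodType)
  (@fihom k) (fun V W f n x => f n x) _ fi_id _ fi_comp _ fi_subh _
  (fun V W f => fi_sub (fi_ker f)) (fun V W f => fi_inc (fi_ker f)) _ _ fi_mono_lift
  (@fi_dsum k) fi_in1 fi_in2 fi_pr1 fi_pr2 _ _ _ _ _) => //.
- by move=> M N f n x y; rewrite linearB.
- by move=> M N f n x y; apply: val_inj.
- move=> M N f n x; split=> [h|[y <-]]; last exact/lkerP/(valP y).
  by exists (exist _ x (introT (lkerP (f n) x) h)).
- by move=> M N n [x y] /=; congr pair; rewrite /= ?addr0 ?add0r.
Defined.

Lemma fi_proj_resE V n : fi_proj_res V n <-> @has_res ficat V n.
Proof. by []. Qed.

End FICat.

(** * Distributive FI-modules *)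

Section InjOrd.

Fact mkinj_subproof m n (f : 'I_m -> 'I_n) : injective f -> injectiveb (finfun f).
Proof. by move=> fi; apply/injectiveP => x y; rewrite !ffunE => /fi. Qed.

Definition mkinj m n (f : 'I_m -> 'I_n) (fi : injective f) : inj_ord m n :=
  exist (fun f : {ffun _ -> _} => injectiveb f) _ (mkinj_subproof fi).

Lemma mkinjE m n (f : 'I_m -> 'I_n) (fi : injective f) x : mkinj fi x = f x.
Proof. by rewrite /inj_ord_fun /= ffunE. Qed.

Lemma inj_ord_factor j m n (f : inj_ord j m) (g : inj_ord n m) :
  (forall a, exists b, g b = f a) -> exists f', f = inj_ord_comp g f'.
Proof.
move=> /choice[h hE].
have hi : injective h by move=> x y xy; apply: (inj_ord_inj (f := f)); rewrite -!hE xy.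
by exists (mkinj hi); apply: inj_ordP => a; rewrite inj_ord_compE mkinjE hE.
Qed.

Lemma inj_ord_leq m n (f : inj_ord m n) : (m <= n)%N.
Proof. by have := leq_card _ (inj_ord_inj (f := f)); rewrite !card_ord. Qed.

Lemma card_inj_ord_im m n (f : inj_ord m n) : #|f @: [set: 'I_m]| = m.
Proof. by rewrite card_imset ?cardsT ?card_ord //; apply: inj_ord_inj. Qed.

Definition inj_enum n (S : {set 'I_n}) : inj_ord #|S| n := mkinj (@enum_val_inj _ (mem S)).

Lemma inj_enumP n (S : {set 'I_n}) a : inj_enum S a \in S.
Proof. by rewrite mkinjE; apply: enum_valP. Qed.

Lemma inj_enum_surj n (S : {set 'I_n}) b : b \in S -> exists a, inj_enum S a = b.
Proof. by move=> bS; exists (enum_rank_in bS b); rewrite mkinjE enum_rankK_in. Qed.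

End InjOrd.

Section Support.
Variables (k : comNzRingType) (V : fimod k).

(* x lies in V_S *)
Definition insupp n (S : {set 'I_n}) (x : V n) : Prop :=
  exists j (f : inj_ord j n) (y : V j), (forall a, f a \in S) /\ x = fi_map f y.

(* x lies in the sum of the V_S for S in F *)
Fixpoint insum n (F : seq {set 'I_n}) (x : V n) : Prop :=
  if F is T :: F' then exists2 y, insupp T y & insum F' (x - y) else x = 0.

(** Every injection with values in S factors through the enumeration of S, so V_S is the image of a
    single linear map and hence a submodule. *)
Lemma insupp_enum n (S : {set 'I_n}) x :
  insupp S x <-> exists y : V #|S|, x = fi_map (inj_enum S) y.
Proof.
split=> [[j [f [y [fS ->]]]]|[y ->]].
  have [a|f' ->] := @inj_ord_factor _ _ _ f (inj_enum S).
    exact/inj_enum_surj/fS.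
  by exists (fi_map f' y); rewrite fi_map_comp.
by exists #|S|, (inj_enum S), y; split=> //; apply: inj_enumP.
Qed.

Lemma insupp0 n (S : {set 'I_n}) : insupp S 0.
Proof. by apply/insupp_enum; exists 0; rewrite linear0. Qed.

Lemma insuppP n (S : {set 'I_n}) a x y :
  insupp S x -> insupp S y -> insupp S (a *: x + y).
Proof.
move=> /insupp_enum[x' ->] /insupp_enum[y' ->]; apply/insupp_enum.
by exists (a *: x' + y'); rewrite linearP.
Qed.

Lemma insuppB n (S : {set 'I_n}) x y : insupp S x -> insupp S y -> insupp S (x - y).
Proof. by rewrite addrC -scaleN1r => hx hy; apply: insuppP. Qed.

Lemma insupp_sub n (S T : {set 'I_n}) x : S \subset T -> insupp S x -> insupp T x.
Proof.
move=> /fintype.subsetP ST [j [f [y [fS ->]]]]; exists j, f, y; split=> // a.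
exact/ST/fS.
Qed.

Lemma insupp_map m n (g : inj_ord m n) (S : {set 'I_m}) x :
  insupp S x -> insupp (g @: S) (fi_map g x).
Proof.
move=> [j [f [y [fS ->]]]]; exists j, (inj_ord_comp g f), y.
by split=> [a|]; rewrite ?fi_map_comp // inj_ord_compE imset_f.
Qed.

Lemma insupp_eq m n (g h : inj_ord m n) (S : {set 'I_m}) x :
  {in S, g =1 h} -> insupp S x -> fi_map g x = fi_map h x.
Proof.
move=> gh [j [f [y [fS ->]]]]; rewrite -!fi_map_comp.
by congr (fi_map _ y); apply: inj_ordP => a; rewrite !inj_ord_compE gh.
Qed.

Lemma insupp_im m n (g : inj_ord m n) x : insupp (g @: [set: 'I_m]) (fi_map g x).
Proof. by exists m, g, x; split=> // a; rewrite imset_f ?inE. Qed.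

Lemma insupp_lift m n (g : inj_ord m n) (S : {set 'I_m}) z :
  insupp (g @: S) z -> exists2 x, insupp S x & z = fi_map g x.
Proof.
move=> [j [f [y [fS zE]]]].
have [a|f' fE] := @inj_ord_factor _ _ _ f g.
  by have /imsetP[b _ ->] := fS a; exists b.
exists (fi_map f' y); last by rewrite zE fE fi_map_comp.
exists j, f', y; split=> // a; have /imsetP[b bS] := fS a.
by rewrite fE inj_ord_compE => /inj_ord_inj ->.
Qed.

Lemma insum0 n (F : seq {set 'I_n}) : insum F 0.
Proof.
by elim: F => //= S F IH; exists 0; [apply: insupp0 | rewrite subr0].
Qed.

Lemma insumP n (F : seq {set 'I_n}) a x y :
  insum F x -> insum F y -> insum F (a *: x + y).
Proof.
elim: F x y => /= [x y -> ->|S F IH x y [x' hx Fx] [y' hy Fy]].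
  by rewrite scaler0 addr0.
exists (a *: x' + y'); first exact: insuppP.
by rewrite opprD addrACA -scalerBr; apply: IH.
Qed.

Lemma insumD n (F : seq {set 'I_n}) x y : insum F x -> insum F y -> insum F (x + y).
Proof. by rewrite -[x in insum F (x + _)]scale1r; apply: insumP. Qed.

Lemma insumB n (F : seq {set 'I_n}) x y : insum F x -> insum F y -> insum F (x - y).
Proof. by rewrite addrC -scaleN1r => hx hy; apply: insumP. Qed.

Lemma insupp_insum n (F : seq {set 'I_n}) (S T : {set 'I_n}) x :
  insupp S x -> S \subset T -> T \in F -> insum F x.
Proof.
elim: F => //= U F IH hx ST; rewrite inE; case/orP => [/eqP TU|TF].
  exists x; last by rewrite subrr; apply: insum0.
  by apply: insupp_sub hx; rewrite -TU.
by exists 0; [apply: insupp0 | rewrite subr0; apply: IH].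
Qed.

Lemma insum_sub n (F G : seq {set 'I_n}) x :
  (forall S, S \in F -> exists2 T, T \in G & S \subset T) -> insum F x -> insum G x.
Proof.
elim: F x => /= [x _ ->|S F IH x h [y hy Fx]]; first exact: insum0.
have [T TG ST] := h S (mem_head _ _).
rewrite -(subrK y x); apply: insumD; last exact: insupp_insum hy ST TG.
by apply: IH Fx => U UF; apply: h; rewrite inE UF orbT.
Qed.

Lemma insum_map m n (g : inj_ord m n) (F : seq {set 'I_m}) x :
  insum F x -> insum [seq g @: (T : {set _}) | T <- F] (fi_map g x).
Proof.
elim: F x => /= [x ->|S F IH x [y hy Fx]]; first exact: linear0.
by exists (fi_map g y); [apply: insupp_map | rewrite -linearB; apply: IH].
Qed.

Lemma insum_lift m n (g : inj_ord m n) (F : seq {set 'I_m}) z :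
  insum [seq g @: (T : {set _}) | T <- F] z -> exists2 x, insum F x & z = fi_map g x.
Proof.
elim: F z => /= [z ->|S F IH z [y /insupp_lift[y' hy ->] /IH[x' Fx zE]]].
  by exists 0; rewrite ?linear0.
exists (x' + y'); last by rewrite linearD /= -zE subrK.
by exists y'; rewrite ?addrK.
Qed.

End Support.

Section SupportHom.
Variables (k : comNzRingType) (V W : fimod k) (h : fihom V W).

Lemma insupp_hom n (S : {set 'I_n}) x : insupp S x -> insupp S (h n x).
Proof.
by move=> [j [f [y [fS ->]]]]; exists j, f, (h j y); rewrite fi_hom_nat.
Qed.

Lemma insum_hom n (F : seq {set 'I_n}) x : insum F x -> insum F (h n x).
Proof.
elim: F x => /= [x ->|S F IH x [y hy Fx]]; first exact: linear0.
by exists (h n y); [apply: insupp_hom | rewrite -linearB; apply: IH].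
Qed.

Lemma insupp_surj n (S : {set 'I_n}) z : fi_surj h -> insupp S z ->
  exists2 x, insupp S x & h n x = z.
Proof.
move=> hs [j [f [y [fS ->]]]]; have [x <-] := hs j y.
by exists (fi_map f x); [exists j, f, x | rewrite fi_hom_nat].
Qed.

Lemma insum_surj n (F : seq {set 'I_n}) z : fi_surj h -> insum F z ->
  exists2 x, insum F x & h n x = z.
Proof.
move=> hs; elim: F z => /= [z ->|S F IH z [y /(insupp_surj hs)[y' hy <-] /IH[x Fx xE]]].
  by exists 0; rewrite ?linear0.
exists (x + y'); first by exists y'; rewrite ?addrK.
by rewrite linearD /= xE subrK.
Qed.

End SupportHom.

Section Good.
Variable k : comNzRingType.
Implicit Types U V W P : fimod k.

Definition distributive V : Prop :=
  (forall m n (f : inj_ord m n) (x : V m), fi_map f x = 0 -> x = 0) /\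
  (forall n (S : {set 'I_n}) F (x : V n), insupp S x -> insum F x ->
     insum [seq S :&: (T : {set _}) | T <- F] x).

Lemma distributive_inj V m n (f : inj_ord m n) : distributive V ->
  injective (fi_map f : V m -> V n).
Proof.
move=> [h _] x y /eqP; rewrite -subr_eq0 -linearB => /eqP/h/eqP.
by rewrite subr_eq0 => /eqP.
Qed.

Definition inj_lshift n : inj_ord n (n + n) := mkinj (@lshift_inj n n).

Definition half_shift n (T : {set 'I_n}) (x : 'I_n) : 'I_(n + n) :=
  if x \in T then lshift n x else rshift n x.

Lemma half_shift_inj n (T : {set 'I_n}) : injective (half_shift T).
Proof.
move=> x y; rewrite /half_shift; case: ifP; case: ifP => _ _ /eqP;
  by rewrite ?eq_lshift ?eq_rshift ?eq_lrshift ?eq_rlshift // => /eqP.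
Qed.

(* Let l embed [n] as the left half of [n + n], and let t agree with l on T and
   send the complement of T to the right half.  The difference of the two maps
   kills W_T, so the image of u under it involves one subset less, and l [n]
   meets t [n] in l T. *)
Lemma insum_pure U W (i : fihom U W) : distributive U ->
  (forall n, injective (i n)) ->
  forall n (F : seq {set 'I_n}) (u : U n), insum F (i n u) -> insum F u.
Proof.
move=> Ud ii n F; have [s] := ubnP (size F).
elim: s n F => // s IH n [|T F] /=; first by move=> _ u /= h; apply: ii; rewrite linear0.
move=> sF u [w wT wF]; pose l := inj_lshift n; pose t := mkinj (@half_shift_inj n T).
have lw : fi_map l w = fi_map t w.
  by apply: insupp_eq wT => x xT; rewrite !mkinjE /half_shift xT.
have tT x : x \notin T -> t x = rshift n x.
  by move=> xT; rewrite mkinjE /half_shift (negPf xT).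
have lE x : l x = lshift n x by rewrite mkinjE.
(* [B X] is [l X] together with the whole right half. It contains both [l X] and [t X], yet meets
   the image of [l] in [l X] only. *)
pose B (X : {set 'I_n}) : {set 'I_(n + n)} :=
  l @: X :|: [set y | [forall x : 'I_n, y != lshift n x]].
have lB (X : {set 'I_n}) : l @: X \subset B X by apply: finset.subsetUl.
have tB (X : {set 'I_n}) : t @: X \subset B X.
  apply/fintype.subsetP => y /imsetP[x xX ->]; rewrite !inE.
  have [xT|/tT->] := boolP (x \in T).
    by rewrite mkinjE /half_shift xT -lE imset_f.
  by apply/orP; right; apply/forallP => z; rewrite eq_rlshift.
have hB : insum (map B F) (i _ (fi_map l u - fi_map t u)).
  rewrite linearB /= !fi_hom_nat.
  have -> : fi_map l (i n u) - fi_map t (i n u) =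
      fi_map l (i n u - w) - fi_map t (i n u - w).
    by rewrite !(linB (fi_map_linear _)) lw opprB addrA subrK.
  apply: insumB.
    apply: insum_sub (insum_map l wF) => _ /mapP[X XF ->].
    by exists (B X); [apply: map_f | apply: lB].
  apply: insum_sub (insum_map t wF) => _ /mapP[X XF ->].
  by exists (B X); [apply: map_f | apply: tB].
have {}hB : insum (t @: [set: 'I_n] :: map B F) (fi_map l u).
  exists (fi_map t u); first exact: insupp_im.
  by apply: IH hB; rewrite size_map.
have {}hB : insum [seq l @: (X : {set _}) | X <- T :: F] (fi_map l u).
  apply: insum_sub (Ud.2 _ _ _ _ (insupp_im l u) hB).
  move=> X; rewrite inE => /orP[/eqP ->|].
    exists (l @: T); first exact: mem_head.
    apply/fintype.subsetP => _ /setIP[/imsetP[x _ ->] /imsetP[y _]].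
    have [yT|/tT->] := boolP (y \in T).
      by rewrite [t y]mkinjE /half_shift yT -lE => ->; rewrite imset_f.
    by rewrite lE => /eqP; rewrite eq_lrshift.
  move=> /mapP[_ /mapP[Y YF ->] ->]; exists (l @: Y).
    by apply/orP; right; apply: (map_f (fun Z : {set 'I_n} => l @: Z)).
  apply/fintype.subsetP => _ /setIP[/imsetP[x _ ->] /setUP[//|]].
  by rewrite inE => /forallP/(_ x); rewrite lE eqxx.
by have [x xF /(distributive_inj Ud) ->] := insum_lift hB.
Qed.

(** Lifts w in W_S and w' in the sum of the W_T of one element of V differ by some u in U. By purity
    u = u1 + u2 with u1 in U_S and u2 in the sum of the U_T, so w - u1 = w' + u2 lies in both and
    distributivity of W applies. Injectivity is purity for the one-element family given by the image
    of f. *)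
Lemma distributive_quot U W V (i : fihom U W) (e : fihom W V) :
  distributive U -> distributive W -> (forall n, injective (i n)) -> fi_surj e ->
  (forall n (x : W n), e n x = 0 <-> exists y, i n y = x) -> distributive V.
Proof.
move=> Ud Wd ii es ie; split=> [m n f x|n S F x xS xF].
  have [w <-] := es m x; rewrite -fi_hom_nat => /ie[u uE].
  have : insum [:: f @: [set: 'I_m]] (i n u).
    by exists (i n u); rewrite ?subrr // uE; apply: insupp_im.
  move/(insum_pure Ud ii)=> [u' /insupp_lift[v _ ->] /eqP].
  rewrite subr_eq0 => /eqP uv; apply/ie; exists v.
  by apply: (distributive_inj (f := f) Wd); rewrite -uE uv fi_hom_nat.
have [w wS we] := insupp_surj es xS; have [w' wF we'] := insum_surj es xF.
have /ie[u uE] : e n (w - w') = 0 by rewrite linearB /= we we' subrr.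
have : insum (S :: F) (i n u).
  by rewrite uE; exists w => //; rewrite addrC addKr -sub0r; apply: insumB => //; apply: insum0.
move/(insum_pure Ud ii)=> [u1 u1S u1F].
have := Wd.2 n S F (w - i n u1).
rewrite -we; have -> : e n w = e n (w - i n u1).
  by rewrite linearB /= [e n (i n u1)](_ : _ = 0) ?subr0 //; apply/ie; exists u1.
move=> h; apply/insum_hom/h; first exact/insuppB/insupp_hom.
have -> : w - i n u1 = w' + i n (u - u1) by rewrite linearB /= uE addrA [w' + _]addrC subrK.
by apply: insumD => //; apply: insum_hom.
Qed.

Lemma distributive_retract V W (s : fihom V W) (r : fihom W V) :
  (forall n x, r n (s n x) = x) -> distributive W -> distributive V.
Proof.
move=> rs Wd; split=> [m n f x x0|n S F x xS xF].
  by rewrite -[x]rs (Wd.1 _ _ f (s m x)) ?linear0 // -fi_hom_nat x0 linear0.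
rewrite -[x]rs; apply: insum_hom; apply: Wd.2; first exact: insupp_hom.
exact: insum_hom.
Qed.

End Good.

(** * Distributivity of projective FI-modules *)

Section DependentProduct.
Variables (R : pzRingType) (I : Type) (M : I -> lmodType R).

Definition dprod : Type := forall i, M i.

HB.instance Definition _ := gen_eqMixin dprod.
HB.instance Definition _ := gen_choiceMixin dprod.

Lemma dprodP (x y : dprod) : (forall i, x i = y i) -> x = y.
Proof. exact: functional_extensionality_dep. Qed.

Definition dprod_zero : dprod := fun i => 0.
Definition dprod_opp (x : dprod) : dprod := fun i => - x i.
Definition dprod_add (x y : dprod) : dprod := fun i => x i + y i.
Definition dprod_scale a (x : dprod) : dprod := fun i => a *: x i.

Fact dprod_addA : associative dprod_add.
Proof. by move=> x y z; apply: dprodP => i; apply: addrA. Qed.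
Fact dprod_addC : commutative dprod_add.
Proof. by move=> x y; apply: dprodP => i; apply: addrC. Qed.
Fact dprod_add0 : left_id dprod_zero dprod_add.
Proof. by move=> x; apply: dprodP => i; apply: add0r. Qed.
Fact dprod_addN : left_inverse dprod_zero dprod_opp dprod_add.
Proof. by move=> x; apply: dprodP => i; apply: addNr. Qed.

HB.instance Definition _ := GRing.isZmodule.Build dprod
  dprod_addA dprod_addC dprod_add0 dprod_addN.

Fact dprod_scaleA a b x : dprod_scale a (dprod_scale b x) = dprod_scale (a * b) x.
Proof. by apply: dprodP => i; apply: scalerA. Qed.
Fact dprod_scale1 : left_id 1 dprod_scale.
Proof. by move=> x; apply: dprodP => i; apply: scale1r. Qed.
Fact dprod_scaleDr : right_distributive dprod_scale +%R.
Proof. by move=> a x y; apply: dprodP => i; apply: scalerDr. Qed.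
Fact dprod_scaleDl x : {morph dprod_scale^~ x : a b / a + b}.
Proof. by move=> a b; apply: dprodP => i; apply: scalerDl. Qed.

HB.instance Definition _ := GRing.Zmodule_isLmodule.Build R dprod
  dprod_scaleA dprod_scale1 dprod_scaleDr dprod_scaleDl.

End DependentProduct.

Section ProjectiveDistributive.
Variable k : comNzRingType.
Implicit Types V P : fimod k.

Definition fi_prod (I : Type) (V : I -> fimod k) : fimod k.
Proof.
apply: (@FIMod k (fun m => dprod (fun i => V i m) : lmodType k)
  (fun m n f (x : dprod (fun i => V i m)) (i : I) => fi_map f (x i))).
- by move=> m n f a x y; apply: dprodP => i; apply: linearP.
- by move=> m x; apply: dprodP => i; apply: fi_map_id.
- by move=> m n p g f x; apply: dprodP => i; apply: fi_map_comp.
Defined.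

Definition fi_prod_proj (I : Type) (V : I -> fimod k) i : fihom (fi_prod V) (V i).
Proof. by apply: (@FIHom k (fi_prod V) (V i) (fun m (x : dprod _) => x i)). Defined.

Lemma insupp_prod (I : Type) (V : I -> fimod k) n (S : {set 'I_n}) (x : fi_prod V n) :
  (forall i, insupp S (fi_prod_proj V i n x)) -> insupp S x.
Proof.
move=> h.
have {}h i : exists y : V i #|S|, fi_prod_proj V i n x = fi_map (inj_enum S) y.
  exact/insupp_enum.
apply/insupp_enum; exists (fun i => projT1 (boolp.cid (h i))); apply: dprodP => i.
exact: (projT2 (boolp.cid (h i))).
Qed.

(** The family F is the same for all components, so decompositions chosen componentwise assemble
    into one of x. *)
Lemma insum_prod (I : Type) (V : I -> fimod k) n (F : seq {set 'I_n})
    (x : fi_prod V n) :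
  (forall i, insum F (fi_prod_proj V i n x)) -> insum F x.
Proof.
elim: F x => /= [x x0|S F IH x h]; first exact: dprodP.
have {}h i : exists y : V i n, insupp S y /\ insum F (fi_prod_proj V i n x - y).
  by have [y] := h i; exists y.
exists (fun i => projT1 (boolp.cid (h i))).
  by apply: insupp_prod => i; exact: (projT2 (boolp.cid (h i))).1.
by apply: IH => i; exact: (projT2 (boolp.cid (h i))).2.
Qed.

Lemma distributive_prod (I : Type) (V : I -> fimod k) :
  (forall i, distributive (V i)) -> distributive (fi_prod V).
Proof.
move=> Vd; split=> [m n f x x0|n S F x xS xF].
  by apply: dprodP => i; apply: ((Vd i).1 _ _ f); apply: (congr1 (fun z => z i) x0).
by apply: insum_prod => i; apply: (Vd i).2; [apply: insupp_hom | apply: insum_hom].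
Qed.

(* the tensor product over k of C(j, -) and T *)
Definition fi_free (j : nat) (T : lmodType k) : fimod k.
Proof.
apply: (@FIMod k (fun m => {ffun inj_ord j m -> T} : lmodType k)
  (fun m n g => push (inj_ord_comp g))).
- by move=> m n g; apply: push_linear.
- by move=> m x; apply: push_id => f; rewrite inj_ord_comp1l.
- by move=> m n p g f x; apply: push_comp => h; rewrite inj_ord_compA.
Defined.

Lemma inj_ord_comp_cancel j m n (g : inj_ord m n) :
  injective (inj_ord_comp g : inj_ord j m -> inj_ord j n).
Proof.
move=> f f' ff'; apply: inj_ordP => a; apply: (inj_ord_inj (f := g)).
by rewrite -!inj_ord_compE ff'.
Qed.

Lemma push_injE (M : lmodType k) (X Y : finType) (u : X -> Y) (a : {ffun X -> M}) x :
  injective u -> push u a (u x) = a x.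
Proof.
by move=> ui; rewrite ffunE (big_pred1 x) // => y; rewrite (inj_eq ui).
Qed.

(** Membership in V_S becomes a condition on the support of a function, which can be tested
    coefficient by coefficient. *)
Lemma insupp_free j T n (S : {set 'I_n}) (x : fi_free j T n) :
  insupp S x <-> forall f : inj_ord j n, (x : {ffun inj_ord j n -> T}) f != 0 ->
    forall a, inj_ord_fun f a \in S.
Proof.
split=> [/insupp_enum[y ->] f|h].
  rewrite ffunE => yf a; apply: contraNT yf => aS.
  rewrite big1 // => g /eqP gf; case/negP: aS; rewrite -gf inj_ord_compE.
  exact: inj_enumP.
apply/insupp_enum.
exists [ffun g => (x : {ffun inj_ord j n -> T}) (inj_ord_comp (inj_enum S) g)].
apply/ffunP => f; have [fS|fS] := boolP [forall a, inj_ord_fun f a \in S].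
  have [a|g ->] := @inj_ord_factor _ _ _ f (inj_enum S).
    exact/inj_enum_surj/(forallP fS).
  by rewrite push_injE ?ffunE //; apply: inj_ord_comp_cancel.
have -> : (x : {ffun inj_ord j n -> T}) f = 0.
  by apply/eqP; apply: contraNT fS => /h fS; apply/forallP.
rewrite ffunE big1 // => g /eqP gf; case/negP: fS; apply/forallP => a.
by rewrite -gf inj_ord_compE inj_enumP.
Qed.

(** Cutting a function down to the injections with values in S is additive, fixes V_S and sends V_T
    into V_(S :&: T); it is applied to a decomposition of x term by term. *)
Lemma distributive_free j T : distributive (fi_free j T).
Proof.
split=> [m n f x x0|n S F x /insupp_free xS xF].
  apply/ffunP => g; rewrite ffunE -(push_injE x g (@inj_ord_comp_cancel _ _ _ f)).
  have := congr1 (fun z : {ffun inj_ord j n -> T} => z (inj_ord_comp f g)) x0.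
  by rewrite [RHS]ffunE.
pose r (y : {ffun inj_ord j n -> T}) : fi_free j T n :=
  [ffun f : inj_ord j n => if [forall a, inj_ord_fun f a \in S] then y f else 0].
have -> : x = r x.
  apply/ffunP => f; rewrite ffunE; case: ifP => // /negbT fS; apply/eqP.
  by apply: contraNT fS => /xS fS; apply/forallP.
elim: F x xF {xS} => /= [x ->|T' F IH x [y /insupp_free yT xF]].
  by apply/ffunP => f; rewrite !ffunE; case: ifP.
exists (r y).
  apply/insupp_free => f; rewrite ffunE; case: ifP => [/forallP fS /yT fT a|].
    by rewrite inE fS fT.
  by rewrite eqxx.
have -> : r x - r y = r (x - y).
  by apply/ffunP => f; rewrite !ffunE; case: ifP => // _; rewrite subr0.
exact: IH.
Qed.

(** A product does the work of the sum over j: in degree m the factors with j > m vanish because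
    C(j, m) is empty, so the two agree and no finiteness of supports has to be tracked. *)
Definition fi_cover V : fimod k := fi_prod (fun j => fi_free j (V j)).

Definition fi_cover_fun V m (x : fi_cover V m) : V m :=
  \sum_(j < m.+1) \sum_(f : inj_ord j m) fi_map f ((fi_prod_proj _ j m x : {ffun _ -> _}) f).

Definition fi_cover_hom V : fihom (fi_cover V) V.
Proof.
apply: (@FIHom k (fi_cover V) V (@fi_cover_fun V)) => [n a x y|m n g x].
  rewrite /fi_cover_fun scaler_sumr -big_split; apply: eq_bigr => j _ /=.
  rewrite scaler_sumr -big_split; apply: eq_bigr => f _ /=.
  by rewrite -linearP; congr fi_map; rewrite !ffunE.
have [nm|mn] := ltnP n m; first by have := inj_ord_leq g; rewrite leqNgt nm.
rewrite /fi_cover_fun linear_sum /=.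
(* The sum in degree n has more indices than that in degree m; those with m < j contribute nothing,
   since there is no injection of [j] into [m]. *)
rewrite (big_ord_widen_cond n.+1 xpredT
  (fun j => fi_map g (\sum_(f : inj_ord j m) fi_map f ((x j : {ffun _ -> _}) f)))) //.
rewrite [RHS]big_mkcond /=; apply: eq_bigr => j _.
rewrite linear_sum /=; transitivity (\sum_(f : inj_ord j m)
   fi_map (inj_ord_comp g f) ((x j : {ffun inj_ord j m -> V j}) f)).
  under eq_bigr do rewrite ffunE linear_sum /=.
  rewrite (exchange_big_dep xpredT) //=; apply: eq_bigr => f _.
  by rewrite (big_pred1 (inj_ord_comp g f)) // => h; rewrite eq_sym.
case: ltnP => [_|mj]; first by apply: eq_bigr => f _; rewrite fi_map_comp.
by rewrite big1 // => f; have := inj_ord_leq f; rewrite leqNgt mj.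
Defined.

Lemma fi_cover_surj V : fi_surj (fi_cover_hom V).
Proof.
move=> m y.
pose z : fi_free m (V m) m := [ffun f => if f == inj_ord_id m then y else 0].
(* The family equal to [z] at m and 0 elsewhere. Its components have different types, hence the cast
   along m = j, which [eq_axiomK] later removes. *)
pose x : fi_cover V m := fun j => if @eqP _ m j is ReflectT e
  then eq_rect m (fun j => fi_free j (V j) m) z j e else 0.
exists x; rewrite [LHS]/= /fi_cover_fun (bigD1 ord_max) //=.
rewrite [X in _ + X]big1 ?addr0 => [|j /eqP jm]; last first.
  apply: big1 => f _; rewrite /x; case: eqP => [e|_]; last by rewrite ffunE linear0.
  by case: jm; apply: val_inj.
rewrite /x; case: eqP => // e; rewrite (eq_axiomK e) /= (bigD1 (inj_ord_id m)) //=.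
rewrite ffunE eqxx fi_map_id big1 ?addr0 // => f /negPf fm.
by rewrite ffunE fm linear0.
Qed.

Lemma distributive_projective P : fi_projective P -> distributive P.
Proof.
move=> hP; have [s sE] := hP _ _ _ (fi_id P) (@fi_cover_surj P).
apply: (distributive_retract sE); apply: distributive_prod => j.
exact: distributive_free.
Qed.

Lemma distributive_pd d V : @pd_le (ficat k) d V -> distributive V.
Proof.
elim: d V => [|d IH] V; first exact: distributive_projective.
move=> [K [P [i [e [[ii ie es] /distributive_projective Pd /IH Kd]]]]].
exact: (@distributive_quot _ K P V i e Kd Pd ii es ie).
Qed.

End ProjectiveDistributive.

(** * Zeroth homology *)

Section GroupAlgebraModules.
Variables (k : comNzRingType) (i : nat).
Local Notation A := (grpalg k i).

Lemma ga_scale_sum (T : lmodType A) (a : A) (t : T) :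
  a *: t = \sum_s ((a s : k)%:A : A) *: (ga_delta k s *: t).
Proof.
have {1}-> : a = \sum_s (a s : k) *: ga_delta k s.
  apply/ffunP => h; rewrite sum_ffunE (bigD1 h) //= big1 ?addr0 => [|s sh].
    by rewrite !ffunE eqxx; apply/esym/mulr1.
  by rewrite !ffunE eq_sym (negPf sh); apply: mulr0.
by rewrite scaler_suml; apply: eq_bigr => s _; rewrite scalerA mulr_algl.
Qed.

(** The permutations span kS_i over k, so kS_i-linearity splits into additivity, k-homogeneity and
    equivariance, which are the conditions that FI-module maps provide. *)
Lemma ga_linear (X Y : lmodType A) (f : X -> Y) : {morph f : x y / x + y} ->
  (forall c x, f ((c%:A : A) *: x) = (c%:A : A) *: f x) ->
  (forall s x, f (ga_delta k s *: x) = ga_delta k s *: f x) -> linear f.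
Proof.
move=> fD fZ fs a x y; rewrite fD; congr (_ + _).
rewrite !(ga_scale_sum a) (big_morph f fD (id1 := 0)).
  by apply: eq_bigr => s _; rewrite fZ fs.
by apply: (addrI (f 0)); rewrite -fD !addr0.
Qed.

Lemma ga_deltaM (s t : inj_ord i i) :
  ga_delta k s * ga_delta k t = ga_delta k (inj_ord_comp s t).
Proof.
apply: ga_ext => M F; rewrite ga_mul_sum ga_delta_sum.
under eq_bigr do under eq_bigr do rewrite -scalerA.
under eq_bigr do rewrite -scaler_sumr ga_delta_sum.
by rewrite ga_delta_sum.
Qed.

Lemma ga_delta1 : ga_delta k (inj_ord_id i) = 1 :> A.
Proof. by []. Qed.

Lemma ga_algC (c : k) (a : A) (T : lmodType A) (t : T) :
  a *: ((c%:A : A) *: t) = (c%:A : A) *: (a *: t).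
Proof. by rewrite !scalerA mulr_algl -scalerAr mulr1. Qed.

Lemma fi_at_delta (V : fimod k) s (x : fi_at V i) : ga_delta k s *: x = fi_map s (x : V i).
Proof. exact: ga_delta_sum. Qed.

Lemma fi_at_alg (V : fimod k) (c : k) (x : fi_at V i) : (c%:A : A) *: x = c *: (x : V i).
Proof.
transitivity (c *: \sum_s (ga_delta k (inj_ord_id i) s : k) *: fi_map s (x : V i)).
  rewrite scaler_sumr; apply: eq_bigr => s _.
  by rewrite scalerA [(c%:A : A) s]ffunE.
by rewrite ga_delta_sum fi_map_id.
Qed.

Lemma restr_scaleE (T : lmodType A) (c : k) (x : restr T) : c *: x = (c%:A : A) *: (x : T).
Proof. by []. Qed.

Lemma fi_at_homo_linear (V W : fimod k) (h : fihom V W) :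
  linear (h i : fi_at V i -> fi_at W i).
Proof.
apply: ga_linear => [x y|c x|s x].
- exact: (linearD (mklin (fi_hom_linear h i)) x y).
- by rewrite !fi_at_alg; exact: (linearZZ (mklin (fi_hom_linear h i)) c x).
- by rewrite !fi_at_delta fi_hom_nat.
Qed.

Definition fi_at_hom (V W : fimod k) (h : fihom V W) :
  {linear fi_at V i -> fi_at W i} := mklin (fi_at_homo_linear h).

Lemma to_fi_at_linear (T : lmodType A) (V : fimod k) (f : T -> V i) :
  linear (f : restr T -> V i) -> (forall s x, f (ga_delta k s *: x) = fi_map s (f x)) ->
  linear (f : T -> fi_at V i).
Proof.
move=> fl fs; apply: ga_linear => [x y|c x|s x].
- by have := fl 1 x y; rewrite !scale1r.
- by have := linearZZ (mklin fl) c x; rewrite fi_at_alg.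
- by rewrite fi_at_delta fs.
Qed.

Lemma from_fi_at_linear (T : lmodType A) (V : fimod k) (f : V i -> T) :
  linear (f : V i -> restr T) -> (forall s x, f (fi_map s x) = ga_delta k s *: f x) ->
  linear (f : fi_at V i -> T).
Proof.
move=> fl fs; apply: ga_linear => [x y|c x|s x].
- by have := fl 1 x y; rewrite !scale1r.
- by rewrite fi_at_alg; apply: (linearZZ (mklin fl) c x).
- by rewrite fi_at_delta fs.
Qed.

(* Hom_k(C(-, i), M), the right adjoint of evaluation at i *)
Definition fi_coind (M : lmodType k) : fimod k.
Proof.
apply: (@FIMod k (fun m => {ffun inj_ord m i -> M} : lmodType k)
  (fun m n g (x : {ffun inj_ord m i -> M}) =>
     [ffun f : inj_ord n i => x (inj_ord_comp f g)])).
- by move=> m n g a x y; apply/ffunP => f; rewrite !ffunE.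
- by move=> m x; apply/ffunP => f; rewrite ffunE inj_ord_comp1r.
- by move=> m n p g f x; apply/ffunP => h; rewrite !ffunE inj_ord_compA.
Defined.

Section Concentrated.
Variable T : lmodType A.

(** Equivariant functions C(m, i) -> T, cut off below degree i, where they must vanish; the part in
    degrees at least i is a submodule. Above i nothing is left, as C(m, i) is empty. *)
Definition conc_pred m : {pred fi_coind (restr T) m} :=
  [pred x : {ffun inj_ord m i -> restr T} |
    `[< (forall s f, x (inj_ord_comp s f) = ga_delta k s *: (x f : T)) /\
        ((m < i)%N -> x = 0) >]].

Lemma conc_closed m : submod_closed (@conc_pred m).
Proof.
split=> [|a x y /asboolP[x1 x2] /asboolP[y1 y2]]; apply/asboolP; split=> //.
- by move=> s f; rewrite !ffunE scaler0.
- move=> s f; rewrite !ffunE x1 y1 scalerDr; congr (_ + _).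
  by rewrite !restr_scaleE ga_algC.
- by move=> mi; rewrite x2 // y2 // scaler0 addr0.
Qed.

(* T placed in degree i: at i, an equivariant function on S_i is determined by
   its value at the identity. *)
Definition conc_sub : fisub (fi_coind (restr T)).
Proof.
apply: (@FISub k (fi_coind (restr T)) (fun m => Submod (@conc_closed m))).
move=> m n g x /asboolP[x1 x2]; apply/asboolP; split=> [s f|ni].
  by rewrite !ffunE -inj_ord_compA x1.
rewrite x2; last exact: leq_ltn_trans (inj_ord_leq g) ni.
by apply/ffunP => f; rewrite !ffunE.
Defined.

Definition conc : fimod k := fi_sub conc_sub.

Definition conc_val m (x : conc m) : {ffun inj_ord m i -> restr T} :=
  val (x : subm (conc_sub m)).

Lemma conc_equiv m (x : conc m) s f :
  conc_val x (inj_ord_comp s f) = ga_delta k s *: (conc_val x f : T).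
Proof. by have /asboolP[h _] := valP (x : subm (conc_sub m)); apply: h. Qed.

Lemma conc_lt m (x : conc m) : (m < i)%N -> x = 0.
Proof.
by move=> mi; apply: val_inj; have /asboolP[_ ->] := valP (x : subm (conc_sub m)).
Qed.

Lemma conc_gt m (x : conc m) : (i < m)%N -> x = 0.
Proof.
move=> im; apply: val_inj; apply/ffunP => f.
by have := inj_ord_leq f; rewrite leqNgt im.
Qed.

Lemma conc_ext (x y : conc i) :
  conc_val x (inj_ord_id i) = conc_val y (inj_ord_id i) -> x = y.
Proof.
move=> xy; apply: val_inj; apply/ffunP => f.
by rewrite -[f]inj_ord_comp1r -!/(conc_val _) !conc_equiv xy.
Qed.

Lemma conc_counit_linear :
  linear (fun x : fi_at conc i => conc_val (x : conc i) (inj_ord_id i) : T).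
Proof.
apply: from_fi_at_linear => [a x y|s x]; first by rewrite /conc_val !ffunE.
by rewrite -conc_equiv inj_ord_comp1r /conc_val ffunE inj_ord_comp1l.
Qed.

Fact conc_unit_subproof (t : T) :
  ([ffun f => ga_delta k f *: t] : {ffun inj_ord i i -> restr T}) \in conc_sub i.
Proof.
by apply/asboolP; split=> [s f|]; rewrite ?ltnn // !ffunE scalerA ga_deltaM.
Qed.

Definition conc_unit (t : T) : conc i :=
  exist (fun x : fi_coind (restr T) i => x \in conc_sub i) _ (conc_unit_subproof t).

Lemma conc_unitE t : conc_val (conc_unit t) (inj_ord_id i) = t.
Proof. by rewrite /conc_val /= ffunE ga_delta1 scale1r. Qed.

End Concentrated.

Lemma conc_map_subproof (T T' : lmodType A) (f : {linear T -> T'}) m (x : conc T m) :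
  ([ffun h => f (conc_val x h)] : {ffun inj_ord m i -> restr T'}) \in conc_sub T' m.
Proof.
apply/asboolP; split=> [s h|mi]; first by rewrite !ffunE conc_equiv linearZ.
by apply/ffunP => h; rewrite (conc_lt x mi) !ffunE linear0.
Qed.

Definition conc_hom (T T' : lmodType A) (f : {linear T -> T'}) : fihom (conc T) (conc T').
Proof.
apply: (@FIHom k (conc T) (conc T') (fun m x =>
  exist (fun x : fi_coind (restr T') m => x \in conc_sub T' m) _
    (conc_map_subproof f x))).
- move=> m a x y; apply: val_inj; apply/ffunP => h; rewrite !ffunE linearD; congr (_ + _).
  by rewrite !restr_scaleE linearZ.
- by move=> m n g x; apply: val_inj; apply/ffunP => h; rewrite !ffunE.
Defined.

Lemma conc_hom_surj (T T' : lmodType A) (f : {linear T -> T'}) :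
  surjective f -> fi_surj (conc_hom f).
Proof.
move=> fs m y; have [mi|im|mi] := ltngtP m i.
- by exists 0; rewrite linear0 (conc_lt y mi).
- by exists 0; rewrite linear0 (conc_gt y im).
move: y; rewrite mi => y; have [t tE] := fs (conc_val y (inj_ord_id i)).
exists (conc_unit t); apply: conc_ext; rewrite -tE [LHS]ffunE.
by rewrite conc_unitE.
Qed.

End GroupAlgebraModules.

(** * H_0 in a fixed degree as a functor to kS_i-modules *)

Section H0.
Variable k : comNzRingType.
Implicit Types U V W P : fimod k.

Definition fi_pi V (S : fisub V) : fihom V (fi_quot S).
Proof.
apply: (@FIHom k V (fi_quot S) (fun n x => quotm_pi (S n) x)).
- by move=> n a x y; rewrite linearP.
- move=> m n f x; rewrite /= quotm_map_pi //; first exact: fi_map_linear.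
  exact: fisub_map.
Defined.

Lemma fi_pi_surj V (S : fisub V) : fi_surj (fi_pi S).
Proof. by move=> n; elim/quotm_ind=> x; exists x. Qed.

Lemma fi_piP V (S : fisub V) n (x y : V n) :
  fi_pi S n x = fi_pi S n y <-> x - y \in S n.
Proof. exact: quotm_eq. Qed.

Lemma fi_pi0 V (S : fisub V) n (x : V n) : fi_pi S n x = 0 <-> x \in S n.
Proof. by rewrite -(linear0 (fi_pi S n)) fi_piP subr0. Qed.

(** Composing h with a set-theoretic section of p gives a result independent of the section, hence
    linear and natural. *)
Lemma fi_epi_desc F Q W (p : fihom F Q) (h : fihom F W) : fi_surj p ->
  (forall n x, p n x = 0 -> h n x = 0) ->
  {H : fihom Q W | forall n x, H n (p n x) = h n x}.
Proof.
move=> ps hp; apply: boolp.cid; pose r n := projT1 (choice (ps n)).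
have rE n x : p n (r n x) = x := projT2 (choice (ps n)) x.
have hE n x : h n (r n (p n x)) = h n x.
  by apply/eqP; rewrite -subr_eq0 -linearB /= hp // linearB /= rE subrr.
have hl n : linear (fun x => h n (r n x)).
  by move=> a x y; rewrite -[x in LHS]rE -[y in LHS]rE -linearP hE linearP.
have hn m n (f : inj_ord m n) x : h n (r n (fi_map f x)) = fi_map f (h m (r m x)).
  by rewrite -[x in LHS]rE -fi_hom_nat hE fi_hom_nat.
by exists (FIHom hl hn).
Qed.

Lemma fi_quot_ker V W (S : fisub V) (h : fihom V W) :
  (forall n x, x \in S n -> h n x = 0) -> forall n x, fi_pi S n x = 0 -> h n x = 0.
Proof. by move=> hS n x /fi_pi0/hS. Qed.

Definition fi_quot_desc V W (S : fisub V) (h : fihom V W)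
  (hS : forall n x, x \in S n -> h n x = 0) : fihom (fi_quot S) W :=
  projT1 (fi_epi_desc (@fi_pi_surj V S) (fi_quot_ker hS)).

Lemma fi_quot_descE V W (S : fisub V) (h : fihom V W) hS n (x : V n) :
  @fi_quot_desc V W S h hS n (fi_pi S n x) = h n x.
Proof. exact: (projT2 (fi_epi_desc (@fi_pi_surj V S) (fi_quot_ker hS))). Qed.

Definition small i n : seq {set 'I_n} := enum [set S : {set 'I_n} | (#|S| < i)%N].

Lemma mem_small i n (S : {set 'I_n}) : (S \in small i n) = (#|S| < i)%N.
Proof. by rewrite mem_enum inE. Qed.

(** An injection of [m] has an image of m elements, so what the degrees below i generate is the sum
    of the V_S with S of fewer than i elements. Purity and distributivity thereby apply to the
    filtration. *)
Lemma filt_ltP V i n (x : V n) : x \in filt_lt V i n <-> insum (small i n) x.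
Proof.
split=> [/asboolP h|].
  have cl m : submod_closed [pred y : V m | `[< insum (small i m) y >]].
    split=> [|a y z /asboolP hy /asboolP hz]; apply/asboolP; first exact: insum0.
    exact: insumP.
  have cm m p (f : inj_ord m p) (y : V m) : y \in Submod (cl m) -> fi_map f y \in Submod (cl p).
    move=> /asboolP hy; apply/asboolP; apply: insum_sub (insum_map f hy).
    move=> _ /mapP[T Ts ->]; exists (f @: T) => //.
    by move: Ts; rewrite !mem_small card_imset //; apply: inj_ord_inj.
  suff /asboolP : x \in FISub cm n by [].
  apply: h => m y mi; apply/asboolP.
  apply: (@insupp_insum _ _ _ _ [set: 'I_m] [set: 'I_m]) => //.
    by exists m, (inj_ord_id m), y; split=> [a|]; rewrite ?inE ?fi_map_id.
  by rewrite mem_small cardsT card_ord.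
have : all (fun S : {set 'I_n} => #|S| < i)%N (small i n).
  by apply/allP => S; rewrite mem_small.
elim: (small i n) x => [x _ /= ->|S F IH x /= /andP[Si /IH{}IH] [y yS /IH]].
  exact: (rpred0 (filt_lt V i n)).
move=> h; rewrite -(subrK y x).
apply: (rpredD (h : _ \in in_submod (filt_lt V i n))).
have /insupp_enum[z ->] := yS; apply: fisub_map.
by apply/asboolP => T; apply.
Qed.

Lemma filt_lt_gen V i n (x : V n) : (n < i)%N -> x \in filt_lt V i n.
Proof. by move=> ni; apply/asboolP => T; apply. Qed.

Lemma filt_lt_sub V i (S : fisub V) : (forall n (x : V n), (n < i)%N -> x \in S n) ->
  forall n (x : V n), x \in filt_lt V i n -> x \in S n.
Proof. by move=> h n x /asboolP; apply => m y; apply: h. Qed.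

Lemma filt_lt_hom V W (h : fihom V W) i n (x : V n) :
  x \in filt_lt V i n -> h n x \in filt_lt W i n.
Proof. by move/filt_ltP => hx; apply/filt_ltP; apply: insum_hom. Qed.

Lemma filt_lt_mono V i j n (x : V n) : (i <= j)%N ->
  x \in filt_lt V i n -> x \in filt_lt V j n.
Proof.
by move=> ij; apply: filt_lt_sub => m y mi; apply: filt_lt_gen (leq_trans mi ij).
Qed.

Definition trunc V i : fimod k := fi_quot (filt_lt V i).

Definition trunc_hom V W (h : fihom V W) i : fihom (trunc V i) (trunc W i).
Proof.
apply: (@fi_quot_desc _ _ (filt_lt V i) (fi_comp (fi_pi (filt_lt W i)) h)).
by move=> n x /(filt_lt_hom h); rewrite -fi_pi0.
Defined.

Lemma trunc_homE V W (h : fihom V W) i n (x : V n) :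
  trunc_hom h i n (fi_pi (filt_lt V i) n x) = fi_pi (filt_lt W i) n (h n x).
Proof. exact: fi_quot_descE. Qed.

(* H_0(V)_i with its action of S_i *)
Definition h0 V i : lmodType (grpalg k i) := fi_at (trunc V i) i.

(** Injectivity on the left is purity for the family of subsets with fewer than i elements; the rest
    is right exactness, by lifting such sums along e. *)
Lemma h0_ses U W V (a : fihom U W) (e : fihom W V) i :
  distributive U -> @ses (ficat k) U W V a e ->
  @ses (modcat (grpalg k i)) (h0 U i) (h0 W i) (h0 V i)
    (fi_at_hom i (trunc_hom a i)) (fi_at_hom i (trunc_hom e i)).
Proof.
move=> Ud [ai ae es]; split.
- apply: injP => s x; have [{}x <-] := fi_pi_surj x => h.
  have : trunc_hom a i i (fi_pi _ i x) = 0 by exact: h.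
  rewrite trunc_homE => /fi_pi0/filt_ltP/(insum_pure Ud ai) /filt_ltP xs.
  exact/fi_pi0.
- move=> s x; have [{}x <-] := fi_pi_surj x; split=> [h|[y]].
    have : trunc_hom e i i (fi_pi _ i x) = 0 by exact: h.
    rewrite trunc_homE => /fi_pi0/filt_ltP/(insum_surj es)[w /filt_ltP ws we].
    have /ae[u uE] : e i (x - w) = 0 by rewrite linearB /= we subrr.
    exists (fi_pi _ i u); rewrite [LHS](trunc_homE a i u); apply/fi_piP.
    have -> : a i u = x - w by exact: uE.
    by rewrite addrAC subrr add0r rpredN.
  have [{}y <-] := fi_pi_surj y.
  rewrite [X in X = _](trunc_homE a i y) => <-; apply: etrans (trunc_homE e i (a i y)) _.
  have -> : e i (a i y) = 0 by apply/ae; exists y.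
  exact: linear0.
- move=> s x; have [{}x <-] := fi_pi_surj x; have [w <-] := es i x.
  by exists (fi_pi _ i w); apply: trunc_homE.
Qed.

Section ToConc.
Variables (P : fimod k) (i : nat) (N : lmodType (grpalg k i)) (f : {linear h0 P i -> N}).

Let g (x : P i) : restr N := f (fi_pi (filt_lt P i) i x).

Fact to_conc_linear : linear g.
Proof.
move=> a x y; rewrite restr_scaleE -linearZ -linearD; congr (f _).
by rewrite linearP fi_at_alg.
Qed.

Fact to_conc_subproof m (p : P m) :
  ([ffun s => g (fi_map s p)] : {ffun inj_ord m i -> restr N}) \in conc_sub N m.
Proof.
apply/asboolP; split=> [s t|mi].
  by rewrite !ffunE fi_map_comp /g fi_hom_nat -linearZ fi_at_delta.
apply/ffunP => s; rewrite !ffunE -(linear0 f); congr (f _); apply/fi_pi0.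
exact/fisub_map/filt_lt_gen.
Qed.

(** The transpose of f under the adjunction between H_0(-)_i and [conc]: p goes to the function s
    |-> f [s p]. *)
Definition to_conc : fihom P (conc N).
Proof.
apply: (@FIHom k P (conc N) (fun m p =>
  exist (fun x : fi_coind i (restr N) m => x \in conc_sub N m) _ (to_conc_subproof p))).
- move=> m a x y; apply: val_inj; apply/ffunP => s; rewrite !ffunE -to_conc_linear.
  by rewrite linearP.
- by move=> m n t x; apply: val_inj; apply/ffunP => s; rewrite !ffunE fi_map_comp.
Defined.

End ToConc.

(** H_0(-)_i is left adjoint to [conc], which preserves surjections. *)
Lemma h0_proj P i : fi_projective P -> @proj (modcat (grpalg k i)) (h0 P i).
Proof.
move=> hP M N g f /(_ tt) gs.
have [H HE] := hP _ _ _ (to_conc f) (conc_hom_surj gs).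
(* [conc M] vanishes below degree i, so [H] factors through [trunc P i]; the counit then transposes
   it back to a map out of H_0(P)_i. *)
have H0 n x : x \in filt_lt P i n -> H n x = 0.
  move=> hx; apply/lkerP; apply: (filt_lt_sub (S := fi_ker H)) hx => m y mi.
  by apply/lkerP/conc_lt.
pose h := [the {linear h0 P i -> M} of mklin (@conc_counit_linear k i M) \o
  fi_at_hom i (fi_quot_desc H0)].
exists h => s x; have [{}x <-] := fi_pi_surj x.
have hE : h (fi_pi _ i x) = conc_val (H i x) (inj_ord_id i).
  by rewrite -(fi_quot_descE H0).
apply: (etrans (congr1 g hE)).
have := congr1 (fun z => conc_val z (inj_ord_id i)) (HE i x).
by rewrite /conc_val /= !ffunE fi_map_id.
Qed.

Lemma h0_pd d V i : @pd_le (ficat k) d V -> @pd_le (modcat (grpalg k i)) d (h0 V i).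
Proof.
elim: d V => [|d IH] V; first exact: h0_proj.
move=> [K [P [a [e [h /h0_proj hP hK]]]]].
exists (h0 K i), (h0 P i), (fi_at_hom i (trunc_hom a i)), (fi_at_hom i (trunc_hom e i)).
split=> //; last exact: IH.
exact/h0_ses/h/distributive_pd/hK.
Qed.

Lemma fi_pi_filtP V i n (x y : filt V i n) :
  fi_pi (filt_pred V i) n x = fi_pi (filt_pred V i) n y <->
  fi_pi (filt_lt V i) n (fi_inc _ n x) = fi_pi (filt_lt V i) n (fi_inc _ n y).
Proof. by rewrite !fi_piP. Qed.

(** The inclusion of V^i/V^(i-1) in V/V^(i-1). In degree i it is also onto, since V^i and V agree
    there, and it identifies (V^i/V^(i-1))_i with H_0(V)_i. *)
Definition gr_inc V i : fihom (gr V i) (trunc V i).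
Proof.
apply: (@fi_quot_desc _ _ (filt_pred V i) (fi_comp (fi_pi (filt_lt V i)) (fi_inc _))).
by move=> n x hx; apply/fi_pi0.
Defined.

Lemma gr_incE V i n (x : filt V i n) :
  gr_inc V i n (fi_pi (filt_pred V i) n x) = fi_pi (filt_lt V i) n (fi_inc _ n x).
Proof. exact: fi_quot_descE. Qed.

Lemma gr_inc_inj V i n : injective (gr_inc V i n).
Proof.
move=> x y; have [{}x <-] := fi_pi_surj x; have [{}y <-] := fi_pi_surj y.
by rewrite !gr_incE => /fi_pi_filtP.
Qed.

Lemma gr_inc_surj V i : surjective (gr_inc V i i).
Proof.
move=> y; have [{}y <-] := fi_pi_surj y.
have yi : y \in filt_lt V i.+1 i by apply: filt_lt_gen.
exists (fi_pi (filt_pred V i) i (exist (fun x => x \in filt_lt V i.+1 i) y yi)).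
exact: gr_incE.
Qed.

Lemma gr_pd d V i : @pd_le (ficat k) d V ->
  @pd_le (modcat (grpalg k i)) d (fi_at (gr V i) i : lmodType (grpalg k i)).
Proof.
move=> /(@h0_pd _ _ i); apply: (@pd_le_iso_inv (modcat (grpalg k i)) d _ _
  (fi_at_hom i (gr_inc V i))) => s; [exact: gr_inc_inj | exact: gr_inc_surj].
Qed.

End H0.

(** * Induction from symmetric groups *)

Section Representatives.
Variables i m : nat.
Implicit Types f g e : inj_ord i m.

Lemma inj_ord_has_inv (s : inj_ord i i) :
  {t : inj_ord i i | inj_ord_comp s t = inj_ord_id i /\ inj_ord_comp t s = inj_ord_id i}.
Proof.
apply: boolp.cid; have [a|t tE] := @inj_ord_factor _ _ _ (inj_ord_id i) s.
  have /codomP[b ->] := inj_card_onto (inj_ord_inj (f := s)) (leqnn _) (inj_ord_id i a).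
  by exists b.
exists t; split=> //; apply: (@inj_ord_comp_cancel _ _ _ s).
by rewrite inj_ord_compA -tE inj_ord_comp1l inj_ord_comp1r.
Qed.

Definition inj_ord_inv s := projT1 (inj_ord_has_inv s).

Lemma inj_ord_compV s : inj_ord_comp s (inj_ord_inv s) = inj_ord_id i.
Proof. exact: (projT2 (inj_ord_has_inv s)).1. Qed.

Lemma inj_ord_compVl s : inj_ord_comp (inj_ord_inv s) s = inj_ord_id i.
Proof. exact: (projT2 (inj_ord_has_inv s)).2. Qed.

Lemma inj_ord_compKr (s : inj_ord i i) : injective (fun f => inj_ord_comp f s).
Proof.
move=> f g /(congr1 (fun h => inj_ord_comp h (inj_ord_inv s))).
by rewrite -!inj_ord_compA inj_ord_compV !inj_ord_comp1r.
Qed.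

(* The predicate given to pick depends only on the right S_i-orbit of f, so rep
   is constant on these orbits. *)
Definition rep f : inj_ord i m :=
  odflt f [pick g : inj_ord i m | [exists s : inj_ord i i, inj_ord_comp g s == f]].

Lemma rep_exists f : exists s, f = inj_ord_comp (rep f) s.
Proof.
rewrite /rep; case: pickP => [g /existsP[s /eqP <-]|_] /=; first by exists s.
by exists (inj_ord_id i); rewrite inj_ord_comp1r.
Qed.

Lemma rep_comp f (s : inj_ord i i) : rep (inj_ord_comp f s) = rep f.
Proof.
rewrite /rep; rewrite (eq_pick (Q := fun g => [exists s, inj_ord_comp g s == f])).
  case: pickP => // /(_ f)/existsP[]; exists (inj_ord_id i).
  by rewrite inj_ord_comp1r.
move=> g; apply/existsP/existsP => -[t /eqP tE].
  exists (inj_ord_comp t (inj_ord_inv s)).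
  by rewrite inj_ord_compA tE -inj_ord_compA inj_ord_compV inj_ord_comp1r.
by exists (inj_ord_comp t s); rewrite inj_ord_compA tE.
Qed.

Lemma repK f : rep (rep f) = rep f.
Proof. by have [s {2}->] := rep_exists f; rewrite rep_comp. Qed.

Lemma rep_im f g : (forall a, f a \in g @: [set: 'I_i]) -> rep f = rep g.
Proof.
move=> fg; have [a|s ->] := @inj_ord_factor _ _ _ f g; last exact: rep_comp.
by have /imsetP[b _ ->] := fg a; exists b.
Qed.

(** S_i acts freely on C(i, m) from the right, so f = e s for exactly one representative e and one
    s. *)
Lemma sum_rep (M : nmodType) (F : inj_ord i m -> M) :
  \sum_f F f = \sum_(e | rep e == e) \sum_s F (inj_ord_comp e s).
Proof.
rewrite (partition_big rep (fun e => rep e == e)) => [|f _]; last by rewrite repK.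
apply: eq_bigr => e /eqP ee.
have -> : \sum_s F (inj_ord_comp e s) =
    \sum_(s in [set: inj_ord i i]) F (inj_ord_comp e s).
  by apply: eq_bigl => s; rewrite inE.
rewrite -(big_imset (h := inj_ord_comp e) F) => [|s t _ _]; last exact: inj_ord_comp_cancel.
apply: eq_bigl => f; apply/eqP/imsetP => [<-|[s _ ->]].
  by have [s {1}->] := rep_exists f; exists s.
by rewrite rep_comp.
Qed.

End Representatives.

Section Induced.
Variables (k : comNzRingType) (i : nat).
Local Notation A := (grpalg k i).
Implicit Types T : lmodType A.

Definition ind_pi T : fihom (fi_free i (restr T)) (ind T).
Proof.
apply: (@FIHom k (fi_free i (restr T)) (ind T) (fun m x => quotm_pi (tens_rel T m) x)).
- by move=> m a x y; rewrite linearP.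
- move=> m n f x; rewrite /= quotm_map_pi //; first exact: push_linear.
  exact: tens_rel_map.
Defined.

Lemma ind_pi_surj T : fi_surj (ind_pi T).
Proof. by move=> n; elim/quotm_ind=> x; exists x. Qed.

Lemma ind_pi_rel T m (f : inj_ord i m) s (t : T) :
  ind_pi T m (ptens (inj_ord_comp f s) t) = ind_pi T m (ptens f (ga_delta k s *: t : T)).
Proof. by apply/quotm_eq/asboolP => S; apply; exists f, s, t. Qed.

(** The coordinate of the class of x at the orbit of f. As C(i, m) is free over S_i, the value of
    [ind T] at m is a sum of copies of T indexed by the representatives; [ind_pi0] states that these
    coordinates detect zero. *)
Definition orbsum T m (x : {ffun inj_ord i m -> restr T}) (f : inj_ord i m) : T :=
  \sum_s ga_delta k s *: (x (inj_ord_comp f s) : T).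

Lemma orbsum_rel T m (x : {ffun inj_ord i m -> restr T}) f :
  x \in tens_rel T m -> orbsum x f = 0.
Proof.
have cl : submod_closed [pred y : {ffun inj_ord i m -> restr T} | orbsum y f == 0].
  split=> [|a y z /eqP hy /eqP hz]; apply/eqP.
    by rewrite /orbsum big1 // => s _; rewrite ffunE scaler0.
  have -> : orbsum (a *: y + z) f = (a%:A : A) *: orbsum y f + orbsum z f.
    rewrite /orbsum scaler_sumr -big_split; apply: eq_bigr => s _ /=.
    by rewrite !ffunE scalerDr restr_scaleE ga_algC.
  by rewrite hy hz scaler0 addr0.
move=> /asboolP/(_ (Submod cl)) h; apply/eqP; apply: h => _ [g [s [t ->]]].
apply/eqP; rewrite /orbsum.
under eq_bigr do rewrite !ffunE scalerBr.
rewrite sumrB (reindex (fun u => inj_ord_comp u s)) /=; last first.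
  exists (fun u => inj_ord_comp u (inj_ord_inv s)) => u _;
  by rewrite -inj_ord_compA ?inj_ord_compV ?inj_ord_compVl inj_ord_comp1r.
apply/eqP; rewrite subr_eq0; apply/eqP; apply: eq_bigr => u _.
rewrite inj_ord_compA (inj_eq (@inj_ord_compKr _ _ s)); case: eqP => _.
  by rewrite scalerA ga_deltaM.
by rewrite !scaler0.
Qed.

Lemma ptens_sum T m (x : {ffun inj_ord i m -> restr T}) : x = \sum_f ptens f (x f).
Proof.
apply/ffunP => h; rewrite sum_ffunE (bigD1 h) //= big1 ?addr0 ?ffunE ?eqxx // => f.
by rewrite ffunE eq_sym => /negPf ->.
Qed.

Lemma ptensD T m (f : inj_ord i m) (t u : restr T) : ptens f (t + u) = ptens f t + ptens f u.
Proof. by apply/ffunP => h; rewrite !ffunE; case: ifP; rewrite ?addr0. Qed.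

Lemma ptens0 T m (f : inj_ord i m) : ptens f (0 : restr T) = 0.
Proof. by apply/ffunP => h; rewrite !ffunE; case: ifP. Qed.

Lemma ptensZ T m (f : inj_ord i m) c (t : restr T) : ptens f (c *: t) = c *: ptens f t.
Proof. by apply/ffunP => h; rewrite !ffunE; case: ifP; rewrite ?scaler0. Qed.

Lemma ind_pi_orbsum T m (x : {ffun inj_ord i m -> restr T}) :
  ind_pi T m x = \sum_(e | rep e == e) ind_pi T m (ptens e (orbsum x e)).
Proof.
rewrite {1}(ptens_sum x) linear_sum /= sum_rep; apply: eq_bigr => e _.
rewrite /orbsum (big_morph (ptens e) (@ptensD T m e) (ptens0 T e)).
by rewrite linear_sum /=; apply: eq_bigr => s _; apply: ind_pi_rel.
Qed.

Lemma ind_pi0 T m (x : {ffun inj_ord i m -> restr T}) :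
  ind_pi T m x = 0 <-> forall e, rep e = e -> orbsum x e = 0.
Proof.
split=> [x0|h]; last first.
  rewrite ind_pi_orbsum big1 // => e /eqP/h ->.
  by rewrite ptens0 linear0.
by move=> e _; apply: orbsum_rel; rewrite -[x]subr0; apply/quotm_eq; rewrite linear0.
Qed.

Section FreeExtension.
Variables (T : lmodType A) (M : fimod k) (h : {linear T -> fi_at M i}).

Definition free_ext : fihom (fi_free i (restr T)) M.
Proof.
apply: (@FIHom k (fi_free i (restr T)) M
  (fun m (x : {ffun inj_ord i m -> restr T}) => \sum_f fi_map f (h (x f) : M i))).
- move=> m a x y; rewrite scaler_sumr -big_split; apply: eq_bigr => f _ /=.
  rewrite !ffunE linearD restr_scaleE linearZ /= fi_at_alg.
  exact: fi_map_linear.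
- move=> m n g x; rewrite linear_sum /=.
  under eq_bigr do rewrite ffunE linear_sum linear_sum /=.
  rewrite (exchange_big_dep xpredT) //=; apply: eq_bigr => f _.
  rewrite (big_pred1 (inj_ord_comp g f)) ?fi_map_comp //.
Defined.

Lemma free_ext_ptens m (f : inj_ord i m) (t : T) :
  free_ext m (ptens f t) = fi_map f (h t : M i).
Proof.
rewrite [LHS]/= (bigD1 f) //= big1 ?addr0 ?ffunE ?eqxx // => g /negPf gf.
by rewrite ffunE gf [h 0]linear0 [fi_map g _]linear0.
Qed.

(** Grouping the sum by orbits expresses the extension through the coordinates [orbsum], which
    vanish on the relations. *)
Lemma free_ext_ker m x : ind_pi T m x = 0 -> free_ext m x = 0.
Proof.
have -> : free_ext m x = \sum_(e | rep e == e) free_ext m (ptens e (orbsum x e)).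
  rewrite [LHS]/= sum_rep; apply: eq_bigr => e _.
  rewrite free_ext_ptens /orbsum [h _]linear_sum [fi_map e _]linear_sum /=.
  by apply: eq_bigr => s _; rewrite linearZ /= fi_at_delta fi_map_comp.
move=> /ind_pi0 hx; rewrite big1 // => e /eqP/hx ->.
by rewrite ptens0 linear0.
Qed.

(** The transpose of h under the adjunction between induction and evaluation at i. *)
Definition ind_ext : fihom (ind T) M :=
  projT1 (fi_epi_desc (@ind_pi_surj T) free_ext_ker).

Lemma ind_extE m x : ind_ext m (ind_pi T m x) = free_ext m x.
Proof. exact: (projT2 (fi_epi_desc (@ind_pi_surj T) free_ext_ker)). Qed.

Lemma ind_ext_ptens m (f : inj_ord i m) (t : T) :
  ind_ext m (ind_pi T m (ptens f t)) = fi_map f (h t : M i).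
Proof. by rewrite ind_extE free_ext_ptens. Qed.

End FreeExtension.

Lemma ind_unit_linear T :
  linear (fun t : T => ind_pi T i (ptens (inj_ord_id i) t) : fi_at (ind T) i).
Proof.
apply: to_fi_at_linear => [a t u|s t].
  by rewrite -linearP; congr (ind_pi _ _ _); rewrite ptensD ptensZ.
rewrite -fi_hom_nat -ind_pi_rel /= push_ptens.
by rewrite inj_ord_comp1l inj_ord_comp1r.
Qed.

Definition ind_unit T : {linear T -> fi_at (ind T) i} := mklin (@ind_unit_linear T).

Lemma ind_pi_ptens T m (f : inj_ord i m) t :
  ind_pi T m (ptens f t) = fi_map f (ind_unit T t : ind T i).
Proof. by rewrite -(fi_hom_nat (ind_pi T)) /= push_ptens inj_ord_comp1r. Qed.

Lemma ind_hom_ext T (M : fimod k) (f g : fihom (ind T) M) :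
  (forall t : T, f i (ind_unit T t) = g i (ind_unit T t)) ->
  forall m x, f m x = g m x.
Proof.
move=> fg m z; have [x <-] := ind_pi_surj z.
rewrite (ptens_sum x) !linear_sum /=; apply: eq_bigr => e _.
change (f m (ind_pi T m (ptens e (x e))) = g m (ind_pi T m (ptens e (x e)))).
by rewrite ind_pi_ptens !fi_hom_nat fg.
Qed.

(** Induction is left adjoint to evaluation at i, which preserves surjections. *)
Lemma ind_projective T : @proj (modcat A) T -> fi_projective (ind T).
Proof.
move=> hT M N g f gs.
have [|h hE] := hT (fi_at M i) (fi_at N i) (fi_at_hom i g)
  [the {linear T -> fi_at N i} of fi_at_hom i f \o ind_unit T].
  by move=> s; apply: gs.
exists (ind_ext h) => n x.
apply: (ind_hom_ext (f := fi_comp g (ind_ext h)) (g := f)) => t.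
by rewrite /= -[RHS](hE tt t) ind_ext_ptens fi_map_id.
Qed.

Definition ind_hom T T' (h : {linear T -> T'}) : fihom (ind T) (ind T') :=
  ind_ext [the {linear T -> fi_at (ind T') i} of ind_unit T' \o h].

Lemma ind_homE T T' (h : {linear T -> T'}) m (x : {ffun inj_ord i m -> restr T}) :
  ind_hom h m (ind_pi T m x) = ind_pi T' m [ffun f => h (x f)].
Proof.
rewrite ind_extE /= [X in _ = ind_pi T' m X]ptens_sum linear_sum /=.
by apply: eq_bigr => f _; rewrite ffunE; apply/esym/ind_pi_ptens.
Qed.

Lemma orbsum_map T T' (h : {linear T -> T'}) m (x : {ffun inj_ord i m -> restr T}) f :
  orbsum ([ffun f => h (x f)] : {ffun inj_ord i m -> restr T'}) f = h (orbsum x f).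
Proof. by rewrite linear_sum /=; apply: eq_bigr => s _; rewrite ffunE linearZ. Qed.

(** In the coordinates [orbsum], induction is in each degree a finite sum of copies of the identity
    functor, so exactness can be checked at each representative. *)
Lemma ind_ses (K P T : lmodType A) (a : {linear K -> P}) (e : {linear P -> T}) :
  @ses (modcat A) K P T a e -> @ses (ficat k) _ _ _ (ind_hom a) (ind_hom e).
Proof.
move=> [/(_ tt) ai /(_ tt) ae /(_ tt) es]; split.
- apply: injP => m z; have [x <-] := ind_pi_surj z => h.
  have /ind_pi0{}h := etrans (esym (ind_homE a x)) h.
  apply/(@ind_pi0 K m x) => f /h; rewrite orbsum_map => af.
  by apply: ai; apply: etrans af (esym (linear0 a)).
- move=> m z; have [x <-] := ind_pi_surj z; split=> [h|[y]].
    have /ind_pi0{}h := etrans (esym (ind_homE e x)) h.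
    (* Only the values at representatives matter; 0 is taken elsewhere to have a total choice. *)
    have {}h f : exists y : K, rep f == f -> a y = orbsum x f.
      have [ff|_] := eqVneq (rep f) f; last by exists 0.
      by have /ae[y yE] := etrans (esym (orbsum_map e x f)) (h f ff); exists y.
    have [r rE] := choice h.
    exists (ind_pi K m (\sum_(f | rep f == f) ptens f (r f))).
    apply: etrans (ind_homE a _) _; rewrite [RHS]ind_pi_orbsum -linear_sum.
    congr (ind_pi _ _ _); apply/ffunP => g; rewrite ffunE !sum_ffunE.
    rewrite [a _]linear_sum; apply: eq_bigr => f /rE <-; rewrite !ffunE.
    by case: ifP => // _; rewrite [a 0]linear0.
  have [{}y <-] := ind_pi_surj y => <-; rewrite /= !ind_homE.
  rewrite (_ : [ffun _ => _] = 0) ?linear0 //; apply/ffunP => f; rewrite !ffunE.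
  by apply/ae; exists (y f).
- move=> m z; have [x <-] := ind_pi_surj z; have [r rE] := choice es.
  exists (ind_pi P m [ffun f => r (x f)]); apply: etrans (ind_homE e _) _.
  by congr (ind_pi _ _ _); apply/ffunP => f; rewrite !ffunE; apply: rE.
Qed.

Lemma ind_pd d T : @pd_le (modcat A) d T -> @pd_le (ficat k) d (ind T).
Proof.
elim: d T => [|d IH] T; first exact: ind_projective.
move=> [K [P [a [e [h /ind_projective hP /IH hK]]]]].
by exists (ind K), (ind P), (ind_hom a), (ind_hom e); split=> //; apply: ind_ses h.
Qed.

End Induced.

(** * Graded pieces of a distributive FI-module *)

Section GradedInduced.
Variable k : comNzRingType.
Implicit Types V W : fimod k.

Lemma fi_iso_bij V W (f : fihom V W) :
  (forall n, injective (f n)) -> fi_surj f -> fi_iso W V.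
Proof.
move=> fi fs; have [n x|g gE] := fi_mono_lift (f := fi_id W) fi.
  by have [y <-] := fs n x; exists y.
exists g, f => n; split=> x; first exact: gE.
by apply: fi; apply: gE.
Qed.

Lemma fi_iso_sym V W : fi_iso V W -> fi_iso W V.
Proof. by move=> [f [g fg]]; exists g, f => n; have [] := fg n. Qed.

Variables (V : fimod k) (i : nat).

Definition gr_counit : fihom (ind (fi_at (gr V i) i : lmodType (grpalg k i))) (gr V i) :=
  ind_ext (mklin (@id_linear _ (fi_at (gr V i) i))).

(** The elements of V whose class modulo V^(i-1) is in the image form a submodule containing every
    degree up to i, hence all of V^i. *)
Lemma gr_counit_surj : fi_surj gr_counit.
Proof.
pose H := fi_comp (gr_inc V i) gr_counit.
pose p m : {pred V m} :=
  [pred x : V m | `[< exists z, H m z = fi_pi (filt_lt V i) m x >]].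
have cl m : submod_closed (p m).
  split=> [|a x y /asboolP[z zE] /asboolP[w wE]]; apply/asboolP.
    by exists 0; rewrite !linear0.
  by exists (a *: z + w); rewrite (fi_hom_linear H) (fi_hom_linear (fi_pi _)) zE wE.
have cm m n (f : inj_ord m n) (x : V m) :
    x \in Submod (cl m) -> fi_map f x \in Submod (cl n).
  move=> /asboolP[z zE]; apply/asboolP; exists (fi_map f z).
  by rewrite (fi_hom_nat H) (fi_hom_nat (fi_pi _)) zE.
have hp n (x : V n) : (n < i.+1)%N -> x \in FISub cm n.
  rewrite ltnS leq_eqVlt => /orP[/eqP ni|ni]; apply/asboolP; last first.
    by exists 0; rewrite linear0; apply/esym/fi_pi0/filt_lt_gen.
  move: x; rewrite ni => x; have [w wE] := gr_inc_surj (fi_pi (filt_lt V i) i x).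
  exists (ind_pi _ i (ptens (inj_ord_id i) (w : fi_at (gr V i) i))).
  by rewrite -wE [LHS](congr1 (gr_inc V i i) (ind_ext_ptens _ _ _)) fi_map_id.
move=> m y; have [x <-] := fi_pi_surj y.
have /asboolP[z zE] := filt_lt_sub hp (valP (x : subm (filt_lt V i.+1 m))).
by exists z; apply: gr_inc_inj; rewrite gr_incE.
Qed.

(** If the sum of the [e (v e)] over the representatives lies in V^(i-1), then [e0 (v e0)] lies in a
    sum of V_X with X of at most i elements and X different from the image of [e0]. Such X cannot
    contain that image, so by distributivity [e0 (v e0)] comes from proper subsets of it; cancelling
    [e0] puts [v e0] in V^(i-1). *)
Lemma gr_counit_inj : distributive V -> forall n, injective (gr_counit n).
Proof.
move=> Vd; apply: (injP (C := ficat k) (f := gr_counit)) => m z /=.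
have [x <-] := ind_pi_surj z => Hx; apply/ind_pi0 => e0 re0.
pose y e := orbsum x e : gr V i i.
have [v vE] := choice (fun e => fi_pi_surj (gr_inc V i i (y e))).
have {Hx}vs : \sum_(e | rep e == e) fi_map e (v e) \in filt_lt V i m.
  apply/fi_pi0; transitivity (gr_inc V i m (gr_counit m (ind_pi _ m x))); last first.
    by apply: etrans (congr1 (gr_inc V i m) Hx) (linear0 (gr_inc V i m)).
  rewrite ind_pi_orbsum !linear_sum; apply: eq_bigr => e _.
  apply: etrans (fi_hom_nat (fi_pi (filt_lt V i)) e (v e)) _; rewrite vE.
  apply: etrans (esym (fi_hom_nat (gr_inc V i) e (y e))) _.
  apply: (congr1 (gr_inc V i m)).
  exact/esym/ind_ext_ptens.
suff /fi_pi0 : v e0 \in filt_lt V i i.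
  by rewrite vE => y0; apply: (@gr_inc_inj _ V i i); rewrite [LHS]y0 linear0.
pose im (e : inj_ord i m) := e @: [set: 'I_i].
pose F := [seq X : {set 'I_m} <- enum {set 'I_m} | (#|X| <= i)%N & X != im e0].
have FP (X : {set 'I_m}) : (X \in F) = (#|X| <= i)%N && (X != im e0).
  by rewrite mem_filter mem_enum inE andbT.
have eF : insum F (fi_map e0 (v e0)).
  have -> : fi_map e0 (v e0) = \sum_(e | rep e == e) fi_map e (v e) -
      \sum_(e | (rep e == e) && (e != e0)) fi_map e (v e).
    by rewrite (bigD1 e0) ?re0 //= addrK.
  apply: insumB.
    move: vs => /filt_ltP; apply: insum_sub => X; rewrite mem_small => Xi.
    exists X => //; rewrite FP ltnW //; apply: contraTneq Xi => ->.
    by rewrite card_inj_ord_im ltnn.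
  elim/big_ind: _ => [||e /andP[/eqP ee ne]]; [exact: insum0 | exact: insumD |].
  apply: (insupp_insum (insupp_im e (v e)) (fintype.subxx _)).
  rewrite FP card_inj_ord_im leqnn; apply: contraNneq ne => ee0.
  rewrite -ee -re0; apply/eqP/rep_im => a; rewrite -/(im e0) -ee0.
  by rewrite imset_f.
have := Vd.2 m (im e0) F _ (insupp_im e0 (v e0)) eF.
move=> h; have {h} : insum [seq e0 @: (X : {set _}) | X <- small i i] (fi_map e0 (v e0)).
  apply: insum_sub h => Z /mapP[X]; rewrite FP => /andP[Xi Xe] ->.
  exists (e0 @: (e0 @^-1: X)).
    apply: (map_f (fun Z : {set 'I_i} => e0 @: Z)); rewrite mem_small ltnNge.
    apply: contra Xe => hi.
    have /eqP XT : e0 @^-1: X == [set: 'I_i].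
      by rewrite eqEcard finset.subsetT cardsT card_ord.
    rewrite eq_sym eqEcard card_inj_ord_im Xi andbT.
    apply/fintype.subsetP => _ /imsetP[a _ ->]; have : a \in [set: 'I_i] by rewrite inE.
    by rewrite -XT inE.
  apply/fintype.subsetP => _ /setIP[/imsetP[a _ ->] aX].
  by rewrite imset_f // inE.
by move=> /insum_lift[u us /(distributive_inj Vd) ->]; apply/filt_ltP.
Qed.

Lemma gr_ind : distributive V ->
  fi_iso (gr V i) (ind (fi_at (gr V i) i : lmodType (grpalg k i))).
Proof. by move=> Vd; apply: fi_iso_bij (gr_counit_inj Vd) gr_counit_surj. Qed.

Lemma pd_fi_iso d W W' : fi_iso W W' -> @pd_le (ficat k) d W -> @pd_le (ficat k) d W'.
Proof.
move=> [f [g fg]]; apply: (@pd_le_iso (ficat k) d W W' f) => n.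
  by have [fK _] := fg n; apply: can_inj fK.
by move=> y; exists (g n y); have [_ gK] := fg n; apply: gK.
Qed.

End GradedInduced.

(** * Projective dimension along the filtration *)

Section FiltrationDimension.
Variable k : comNzRingType.
Implicit Types V W : fimod k.

Lemma filt_step_subproof V i n (x : V n) :
  x \in filt_lt V i n -> x \in filt_lt V i.+1 n.
Proof. exact/filt_lt_mono/leqnSn. Qed.

Definition filt_step V i : fihom (fi_sub (filt_lt V i)) (filt V i).
Proof.
apply: (@FIHom k (fi_sub (filt_lt V i)) (filt V i) (fun n x =>
  exist (fun y => y \in filt_lt V i.+1 n) (val (x : subm (filt_lt V i n)))
    (filt_step_subproof (valP x)))).
- by move=> n a x y; apply: (val_inj (sT := subm (filt_lt V i.+1 n))).
- by move=> m n f x; apply: (val_inj (sT := subm (filt_lt V i.+1 n))).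
Defined.

Lemma filt_ses V i : @ses (ficat k) (fi_sub (filt_lt V i)) (filt V i) (gr V i)
  (filt_step V i) (fi_pi (filt_pred V i)).
Proof.
split.
- by move=> n x y /(congr1 val) xy; apply: val_inj.
- move=> n x; split=> [/fi_pi0 xs|[y <-]]; last by apply/fi_pi0; apply: (valP y).
  by exists (exist (fun y => y \in filt_lt V i n) _ xs); apply: val_inj.
- exact: fi_pi_surj.
Qed.

Lemma filt_pd d V n : (forall i, (i < n)%N -> @pd_le (ficat k) d (gr V i)) ->
  @pd_le (ficat k) d (fi_sub (filt_lt V n)).
Proof.
elim: n => [|n IH] h; last first.
  apply: pd_le_ext (filt_ses V n) _ _; last exact: h.
  by apply: IH => i ni; apply: h; apply: ltnW.
(* V^(-1) = 0: no subset has fewer than 0 elements, so the sum is empty. *)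
have z m (x : fi_sub (filt_lt V 0) m) : x = 0.
  apply: val_inj; have /filt_ltP := valP (x : subm (filt_lt V 0 m)).
  suff -> : small 0 m = [::] by [].
  by apply/nilP; rewrite /nilp -cardE; apply/eqP/eq_card0 => S; rewrite inE.
apply: (@pd_le_mono (ficat k) 0) => // M N g f gs.
unshelve eexists.
  apply: (@FIHom k _ M (fun n _ => 0)) => [m a x y|m p t x].
    by rewrite scaler0 addr0.
  by rewrite linear0.
by move=> m x; rewrite (z _ x) !ap0.
Qed.

Lemma decomp_filt V n i (x : V i) : (forall j (y : V j), (j < i)%N -> y \in filt_lt V n j) ->
  x \in decomp V i -> x \in filt_lt V n i.
Proof.
move=> h /asboolP; apply => _ [j [f [y [ji ->]]]].
exact/fisub_map/h.
Qed.

(** A Nakayama argument by induction on the degree: where H_0 vanishes, V_i is generated by the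
    lower degrees. *)
Lemma filt_full V n : (forall i (x : H0 V i), (n < i)%N -> x = 0) ->
  forall i (x : V i), x \in filt_lt V n.+1 i.
Proof.
move=> h i; have [s] := ubnP i; elim: s i => // s IH i si x.
have [ni|ni] := ltnP i n.+1; first exact: filt_lt_gen.
apply: decomp_filt => [j y ji|].
  by apply: IH; apply: leq_trans ji _.
have := h i (quotm_pi (decomp V i) x) ni; rewrite -(linear0 (quotm_pi (decomp V i))).
by move/quotm_eq; rewrite subr0.
Qed.

Lemma filt_full_pd d V n : (forall i (x : V i), x \in filt_lt V n i) ->
  @pd_le (ficat k) d (fi_sub (filt_lt V n)) -> @pd_le (ficat k) d V.
Proof.
move=> h; apply: (@pd_le_iso (ficat k) d _ _ (fi_inc (filt_lt V n))) => m.
  by move=> x y; apply: val_inj.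
by move=> x; exists (exist (fun y => y \in filt_lt V n m) x (h m x)).
Qed.

(** The same d stands on both sides, so the equivalence carries the value of pd(V) and not merely
    its finiteness. Here n is one more than the last index of the filtration. *)
Lemma fi_pd_leP d V n : (forall i (x : V i), x \in filt_lt V n i) ->
  @pd_le (ficat k) d V <->
  forall i, (i < n)%N -> fi_iso (gr V i) (ind (fi_at (gr V i) i : lmodType (grpalg k i))) /\
    @pd_le (modcat (grpalg k i)) d (fi_at (gr V i) i : lmodType (grpalg k i)).
Proof.
move=> hV; split=> [hd i _|h].
  by split; [apply/gr_ind/distributive_pd/hd | apply: gr_pd].
apply: (filt_full_pd hV); apply: filt_pd => i /h[iso hi].
exact: pd_fi_iso (fi_iso_sym iso) (ind_pd hi).
Qed.

End FiltrationDimension.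

(** * Restriction to the base ring *)

Section Restriction.
Variables (k : comNzRingType) (i : nat).
Local Notation A := (grpalg k i).
Implicit Types T P K : lmodType A.

Lemma restr_hom_linear T T' (f : {linear T -> T'}) : linear (f : restr T -> restr T').
Proof. by move=> a x y; rewrite linearD !restr_scaleE linearZ. Qed.

Definition restr_hom T T' (f : {linear T -> T'}) : {linear restr T -> restr T'} :=
  mklin (restr_hom_linear f).

Lemma restr_ses K P T (a : {linear K -> P}) (e : {linear P -> T}) :
  @ses (modcat A) K P T a e ->
  @ses (modcat k) (restr K) (restr P) (restr T) (restr_hom a) (restr_hom e).
Proof. by []. Qed.

Section CoinducedAdjunction.
Variables (T : lmodType A) (N : lmodType k) (f : {linear restr T -> N}).

Lemma coind_adj_linear : linear (fun t : T =>
  [ffun s => f (ga_delta k s *: t)] : fi_at (fi_coind i N) i).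
Proof.
apply: to_fi_at_linear => [c x y|s x]; apply/ffunP => u; rewrite !ffunE.
  by rewrite -linearP scalerDr; congr (f (_ + _)); rewrite !restr_scaleE ga_algC.
by rewrite scalerA ga_deltaM.
Qed.

Definition coind_adj : {linear T -> fi_at (fi_coind i N) i} := mklin coind_adj_linear.

End CoinducedAdjunction.

Definition coind_hom (M N : lmodType k) (g : {linear M -> N}) :
  fihom (fi_coind i M) (fi_coind i N).
Proof.
apply: (@FIHom k (fi_coind i M) (fi_coind i N)
  (fun m (x : {ffun inj_ord m i -> M}) => [ffun f => g (x f)])).
- by move=> m a x y; apply/ffunP => f; rewrite !ffunE linearP.
- by move=> m n f x; apply/ffunP => u; rewrite !ffunE.
Defined.

Lemma coind_hom_surj (M N : lmodType k) (g : {linear M -> N}) :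
  surjective g -> fi_surj (coind_hom g).
Proof.
move=> /choice[r rE] m y; exists [ffun f => r ((y : {ffun inj_ord m i -> N}) f)].
by apply/ffunP => f; rewrite !ffunE rE.
Qed.

(** Restriction is left adjoint to coinduction N |-> Hom_k(kS_i, N), which preserves surjections;
    [coind_adj] is the transpose. *)
Lemma restr_proj P : @proj (modcat A) P -> @proj (modcat k) (restr P).
Proof.
move=> hP M N g f /(_ tt) gs.
have [|h hE] := hP _ _ (fi_at_hom i (coind_hom g)) (coind_adj f).
  by move=> s; apply: coind_hom_surj.
have hl : linear (fun p : restr P => (h p : {ffun inj_ord i i -> M}) (inj_ord_id i)).
  by move=> c x y; rewrite restr_scaleE linearD linearZ /= fi_at_alg !ffunE.
exists (mklin hl) => s p.
have := congr1 (fun z : {ffun inj_ord i i -> N} => z (inj_ord_id i)) (hE tt p).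
by rewrite /= !ffunE ga_delta1 scale1r.
Qed.

Lemma restr_pd d T : @pd_le (modcat A) d T -> @pd_le (modcat k) d (restr T).
Proof.
elim: d T => [|d IH] T; first exact: restr_proj.
move=> [K [P [a [e [h /restr_proj hP /IH hK]]]]].
by exists (restr K : lmodType k), (restr P : lmodType k), (restr_hom a), (restr_hom e).
Qed.

Lemma inj_ord_invM (t u : inj_ord i i) :
  inj_ord_comp (inj_ord_inv (inj_ord_comp t u)) t = inj_ord_inv u.
Proof.
apply: (@inj_ord_comp_cancel _ _ _ u); apply: (@inj_ord_comp_cancel _ _ _ t).
rewrite !inj_ord_compA inj_ord_compV -(inj_ord_compA t u) inj_ord_compV.
by rewrite inj_ord_comp1l inj_ord_comp1r.
Qed.

Lemma inj_ord_inv1 (s : inj_ord i i) :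
  (inj_ord_inv s == inj_ord_id i) = (s == inj_ord_id i).
Proof.
apply/eqP/eqP => [s1|->]; last by rewrite -[LHS]inj_ord_comp1l inj_ord_compV.
by rewrite -[s]inj_ord_comp1r -s1 inj_ord_compV.
Qed.

(** For a finite group, coinduced and induced modules agree, and this formula is the action map from
    the tensor product of kS_i and T over k to T. *)
Lemma coind_trace_linear T : linear (fun x : fi_at (fi_coind i (restr T)) i =>
  \sum_s ga_delta k s *: ((x : {ffun inj_ord i i -> restr T}) (inj_ord_inv s) : T)).
Proof.
apply: from_fi_at_linear => [c x y|t x].
  rewrite restr_scaleE scaler_sumr -big_split; apply: eq_bigr => s _ /=.
  by rewrite !ffunE scalerDr restr_scaleE ga_algC.
rewrite (reindex (inj_ord_comp t)) /=; last first.
  by exists (inj_ord_comp (inj_ord_inv t)) => u _;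
    rewrite inj_ord_compA ?inj_ord_compV ?inj_ord_compVl inj_ord_comp1l.
rewrite scaler_sumr; apply: eq_bigr => u _.
by rewrite ffunE inj_ord_invM scalerA ga_deltaM.
Qed.

Definition coind_trace T : {linear fi_at (fi_coind i (restr T)) i -> T} :=
  mklin (@coind_trace_linear T).

Lemma coind_trace_surj T : surjective (coind_trace T).
Proof.
move=> t; exists [ffun s => if s == inj_ord_id i then t else 0] => /=.
rewrite (bigD1 (inj_ord_id i)) //= big1 ?addr0 => [|s /negPf s1].
  by rewrite ffunE inj_ord_inv1 eqxx ga_delta1 scale1r.
by rewrite ffunE inj_ord_inv1 s1 scaler0.
Qed.

(* Higman's criterion: the identity of a projective kS_i-module is the trace
   of a k-linear endomorphism. *)
Lemma proj_trace P : @proj (modcat A) P ->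
  exists phi : {linear restr P -> restr P}, forall p : P,
    coind_trace P (coind_adj phi p) = p.
Proof.
move=> hP; have [|h hE] := @proj_section (modcat A) _ _ (coind_trace P) hP.
  by move=> s; apply: coind_trace_surj.
have hl : linear (fun p : restr P =>
    (h p : {ffun inj_ord i i -> restr P}) (inj_ord_id i)).
  by move=> c x y; rewrite restr_scaleE linearD linearZ /= fi_at_alg !ffunE.
exists (mklin hl) => p; rewrite -[RHS](hE tt p); apply: (congr1 (coind_trace P)).
apply/ffunP => s; rewrite ffunE /= linearZ /= fi_at_delta ffunE.
by rewrite inj_ord_comp1l.
Qed.

(** As T is k-projective, a has a k-linear retraction r. The trace of phi r, where the trace of phi
    is the identity of K, is a kS_i-linear retraction q of a. Then 1 - a q kills the image of a and
    descends to a section of e. *)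
Lemma proj_cokernel K P T (a : {linear K -> P}) (e : {linear P -> T}) :
  @ses (modcat A) K P T a e -> @proj (modcat A) K -> @proj (modcat A) P ->
  @proj (modcat k) (restr T) -> @proj (modcat A) T.
Proof.
move=> h hK hP hT; have [_ [r [_ rK _]]] := ses_retraction (restr_ses h) hT.
have [phi phiE] := proj_trace hK.
pose q := [the {linear P -> K} of
  coind_trace K \o coind_adj [the {linear restr P -> restr K} of phi \o r]].
have qK x : q (a x) = x.
  rewrite -[RHS]phiE; apply: (congr1 (coind_trace K)); apply/ffunP => s.
  rewrite !ffunE /=; congr (phi _); rewrite -[RHS](rK tt) /=.
  by rewrite linearZ.
have [_ /(_ tt) ae /(_ tt)/choice[g gE]] := h.
pose c := [the {linear P -> P} of mklin (@id_linear _ P) \- (a \o q)].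
have cE x y : e x = e y -> c x = c y.
  move=> /eqP; rewrite -subr_eq0 -linearB => /eqP/ae[z zE].
  apply/eqP; rewrite -subr_eq0 -linearB -zE; apply/eqP.
  by apply: etrans (congr1 (fun y => a z - a y) (qK z)) (subrr _).
have sl : linear (fun t => c (g t)).
  by move=> b t u; rewrite -linearP; apply: cE; rewrite linearP /= ![e _]gE.
apply: (@proj_retract (modcat A) T P (mklin sl) e) hP => s t /=.
rewrite linearB; apply: etrans (congr1 (fun y => y - e (a (q (g t)))) (gE t)) _.
by rewrite [e (a _)](_ : _ = 0) ?subr0 //; apply/ae; exists (q (g t)).
Qed.

(** The covering sequence splits over k, so the syzygy K is k-projective too and by induction
    projective over kS_i; then [proj_cokernel] applies. *)
Lemma proj_of_restr m T : @pd_le (modcat A) m T -> @proj (modcat k) (restr T) ->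
  @proj (modcat A) T.
Proof.
elim: m T => [|m IH] T //= [K [P [a [e [h hP hK]]]]] hT.
apply: (proj_cokernel h _ hP hT); apply: IH hK _.
have [_ [r [_ rK _]]] := ses_retraction (restr_ses h) hT.
exact: proj_retract rK (restr_proj hP).
Qed.

(** A resolution over kS_i restricts to one over k. Its d-th syzygy is therefore k-projective, and
    it still has finite dimension over kS_i. *)
Lemma pd_of_restr m d T : @pd_le (modcat A) m T -> @pd_le (modcat k) d (restr T) ->
  @pd_le (modcat A) d T.
Proof.
elim: d m T => [|d IH] [|m] T; [by []|exact: proj_of_restr|by move=> hT _; apply: (@pd_le_mono _ 0)|].
move=> [K [P [a [e [h hP hK]]]]] hT; exists K, P, a, e; split=> //.
exact: IH hK (pd_le_syzygy (restr_ses h) (restr_proj hP) hT).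
Qed.

(** V_i carries two k-structures, its own and the one through kS_i; they are equal, but not by
    computation. *)
Lemma restr_fi_at_pd d (V : fimod k) :
  @pd_le (modcat k) d (restr (fi_at V i : lmodType A)) <-> @pd_le (modcat k) d (V i).
Proof.
have l1 : linear (fun x : V i => x : restr (fi_at V i : lmodType A)).
  by move=> c x y; rewrite restr_scaleE fi_at_alg.
have l2 : linear (fun x : restr (fi_at V i : lmodType A) => x : V i).
  by move=> c x y; rewrite restr_scaleE fi_at_alg.
split.
  apply: (@pd_le_iso (modcat k) d (restr (fi_at V i : lmodType A)) (V i) (mklin l2)) => s.
    by move=> x y.
  by move=> x; exists x.
apply: (@pd_le_iso (modcat k) d (V i) (restr (fi_at V i : lmodType A)) (mklin l1)) => s.
  by move=> x y.
by move=> x; exists x.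
Qed.

End Restriction.

(** * Extended dimensions and finite generation *)

Section ExtendedDimension.
Local Open Scope ereal_scope.

Lemma ext_nat_le m n : (ext_nat m <= ext_nat n) = (m <= n)%N.
Proof. by rewrite /ext_nat lee_fin lez_nat. Qed.

Lemma inf_ext_natP (P : nat -> Prop) :
  let I := infimum +oo [set ext_nat n | n in [set n | P n]]%classic in
  (I = +oo /\ forall n, ~ P n) \/
  exists m, [/\ I = ext_nat m, P m & forall n, P n -> (m <= n)%N].
Proof.
move=> I; have [[n Pn]|nP] := pselect (exists n, P n); last first.
  left; split=> [|n Pn]; last by apply: nP; exists n.
  rewrite /I /infimum; case: ifPn => // /set0P[_ [n Pn _]].
  by case: nP; exists n.
right; have ex : exists n, `[< P n >] by exists n; apply/asboolP.
have [m /asboolP Pm mP] := ex_minnP ex.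
have {}mP j : P j -> (m <= j)%N by move=> Pj; apply/mP/asboolP.
exists m; split=> //; rewrite /I /infimum ifF; last first.
  by apply/negbTE/set0P; exists (ext_nat m), m.
apply: xget_unique => [|y [yl yu]].
  split=> [_ [j Pj <-]|y yl]; first by rewrite ext_nat_le mP.
  by apply: yl; exists m.
apply/eqP; rewrite eq_le; apply/andP; split; first by apply: yl; exists m.
by apply: yu => _ [j Pj <-]; rewrite ext_nat_le mP.
Qed.

(** A [supremum] bounds its set only once a least upper bound is known to exist: here the greatest
    element if the naturals are bounded, and +oo otherwise. *)
Lemma ext_nat_sup (E : set (\bar int)) x :
  (forall y, E y -> exists n, y = ext_nat n) -> E x -> x <= supremum -oo E.
Proof.
move=> En Ex; apply: ge_supremum_Nmem => //.
have [[N NP]|nb] := pselect (exists N, forall n, E (ext_nat n) -> (n <= N)%N).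
  have [n nE] := En _ Ex; rewrite nE in Ex.
  have ex : exists n, `[< E (ext_nat n) >] by exists n; apply/asboolP.
  have hN j : `[< E (ext_nat j) >] -> (j <= N)%N by move/asboolP/NP.
  have [m /asboolP Em mP] := ex_maxnP ex hN.
  exists (ext_nat m); split=> [y Ey|y yu]; last exact: yu.
  by have [j jE] := En _ Ey; rewrite jE ext_nat_le; apply/mP/asboolP; rewrite -jE.
exists +oo; split=> [y _|y yu]; first exact: leey.
case: y yu => [r||] yu //.
  have [] := nb; exists `|r|%N => n /yu; rewrite /ext_nat lee_fin => nr.
  by rewrite -lez_nat; apply: le_trans nr _; rewrite abszE ler_norm.
by have := yu _ Ex; have [n ->] := En _ Ex.
Qed.

Lemma ext_nat_ltyP (I : \bar int) (P : nat -> Prop) :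
  ((I = +oo /\ forall n, ~ P n) \/
    exists m, [/\ I = ext_nat m, P m & forall n, P n -> (m <= n)%N]) ->
  I < +oo <-> exists n, P n.
Proof.
move=> [[-> nP]|[m [-> Pm _]]]; first by split=> // -[n /nP].
by split=> _; [exists m | rewrite ltry].
Qed.

Section Modules.
Variables (R : pzRingType) (M : lmodType R).

Lemma pdP : (pd M = +oo /\ forall n, ~ @pd_le (modcat R) n M) \/
  exists m, [/\ pd M = ext_nat m, @pd_le (modcat R) m M &
    forall n, @pd_le (modcat R) n M -> (m <= n)%N].
Proof.
have E n : @pd_le (modcat R) n M <-> proj_res M n.
  by rewrite proj_resE; apply: iff_sym; apply: has_resP.
have [[h1 h2]|[m [h1 h2 h3]]] := inf_ext_natP (proj_res M).
  by left; split=> // n /E; apply: h2.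
by right; exists m; split=> // [|n /E]; [apply/E | apply: h3].
Qed.

Lemma pd_lty : pd M < +oo <-> exists n, @pd_le (modcat R) n M.
Proof. exact/ext_nat_ltyP/pdP. Qed.

Lemma pd_le_ext_nat d : pd M <= ext_nat d <-> @pd_le (modcat R) d M.
Proof.
have [[-> h]|[m [-> hm hn]]] := pdP; first by split=> // /h.
rewrite ext_nat_le; split=> [md|]; [exact: pd_le_mono hm | exact: hn].
Qed.

End Modules.

Lemma fi_pdP (k : comNzRingType) (V : fimod k) :
  (fi_pd V = +oo /\ forall n, ~ @pd_le (ficat k) n V) \/
  exists m, [/\ fi_pd V = ext_nat m, @pd_le (ficat k) m V &
    forall n, @pd_le (ficat k) n V -> (m <= n)%N].
Proof.
have E n : @pd_le (ficat k) n V <-> fi_proj_res V n.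
  by rewrite fi_proj_resE; apply: iff_sym; apply: has_resP.
have [[h1 h2]|[m [h1 h2 h3]]] := inf_ext_natP (fi_proj_res V).
  by left; split=> // n /E; apply: h2.
by right; exists m; split=> // [|n /E]; [apply/E | apply: h3].
Qed.

Lemma fi_pd_lty (k : comNzRingType) (V : fimod k) :
  fi_pd V < +oo <-> exists n, @pd_le (ficat k) n V.
Proof. exact/ext_nat_ltyP/fi_pdP. Qed.

(** Finiteness over kS_i matters: over a field of characteristic p <= i, the trivial module has
    dimension 0 over k and infinite dimension over kS_i. *)
Lemma pd_restr (k : comNzRingType) (V : fimod k) i :
  pd (fi_at V i : lmodType (grpalg k i)) < +oo ->
  pd (fi_at V i : lmodType (grpalg k i)) = pd (V i : lmodType k).
Proof.
move=> /pd_lty[m hm]; congr infimum; congr image; apply/seteqP.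
have E n : proj_res (fi_at V i : lmodType (grpalg k i)) n <-> proj_res (V i : lmodType k) n.
  rewrite !proj_resE !has_resP -restr_fi_at_pd.
  by split; [apply: restr_pd | apply: pd_of_restr hm].
by split=> n /E.
Qed.

End ExtendedDimension.

Section FinitelyGenerated.
Variable k : comNzRingType.

Lemma fin_gen_fin (M : lmodType k) (I : finType) (g : I -> M) :
  (forall x, exists c : I -> k, x = \sum_i c i *: g i) -> fin_gen M.
Proof.
move=> h; exists #|I|, (fun j => g (enum_val j)) => x; have [c ->] := h x.
exists (fun j => c (enum_val j)).
by rewrite -(big_enum_val (fun i => c i *: g i)); apply: eq_bigl => i; rewrite inE.
Qed.

Lemma fin_gen_surj (M N : lmodType k) (f : {linear M -> N}) :
  surjective f -> fin_gen M -> fin_gen N.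
Proof.
move=> fs [r [g gP]]; exists r, (fun j => f (g j)) => y.
have [x <-] := fs y; have [c {1}->] := gP x; exists c.
by rewrite linear_sum; apply: eq_bigr => j _; rewrite linearZ.
Qed.

Lemma fin_gen_pair (M N : lmodType k) :
  fin_gen M -> fin_gen N -> fin_gen (M * N)%type.
Proof.
move=> [r [g gP]] [s [h hP]].
apply: (@fin_gen_fin _ ('I_r + 'I_s)%type
  (fun u => match u with inl a => (g a, 0) | inr b => (0, h b) end)) => -[x y].
have [c cE] := gP x; have [d dE] := hP y.
exists (fun u => match u with inl a => c a | inr b => d b end).
rewrite big_sumType /=.
have -> : \sum_(j < r) c j *: ((g j, 0) : M * N) = (x, 0).
  by rewrite cE; elim/big_rec2: _ => // j u v _ ->; congr pair; rewrite /= ?scaler0 ?addr0.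
have -> : \sum_(j < s) d j *: ((0, h j) : M * N) = (0, y).
  by rewrite dE; elim/big_rec2: _ => // j u v _ ->; congr pair; rewrite /= ?scaler0 ?addr0.
by congr pair; rewrite /= ?addr0 ?add0r.
Qed.

(** C(i, m) is finite, so a finite sum of modules [fi_rep k i] has a free value of finite rank in
    each degree. *)
Lemma fi_fin_gen_at (V : fimod k) m : fi_fin_gen V -> fin_gen (V m : lmodType k).
Proof.
move=> [s [f fs]]; apply: (fin_gen_surj (f := mklin (fi_hom_linear f m)) (fs m)).
elim: s {f fs} => [|i s IH] /=.
  exists 0, (fun _ => 0) => x; exists (fun _ => 0); rewrite big_ord0.
  by apply/rowP; case.
apply: fin_gen_pair IH.
apply: (@fin_gen_fin _ (inj_ord i m) (fun f => [ffun g => (g == f)%:R : k^o])) => x.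
exists (fun f => (x : {ffun inj_ord i m -> k^o}) f); apply/ffunP => h.
rewrite sum_ffunE (bigD1 h) //= big1 ?addr0 => [|f /negPf fh].
  by rewrite !ffunE eqxx; apply/esym/mulr1.
by rewrite !ffunE eq_sym fh; apply: mulr0.
Qed.

(** As [gr_inc] is bijective in degree i, the projection of V_i to V/V^(i-1) lifts to a surjection
    onto (V^i/V^(i-1))_i. *)
Lemma gr_fin_gen (V : fimod k) i : fi_fin_gen V -> fin_gen (gr V i i : lmodType k).
Proof.
move=> /(@fi_fin_gen_at _ i).
have [||g gE] := @lmod_mono_lift k (gr V i i) (trunc V i i) (V i)
    (mklin (fi_hom_linear (gr_inc V i) i))
    (mklin (fi_hom_linear (fi_pi (filt_lt V i)) i)).
- by move=> _; apply: gr_inc_inj.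
- by move=> _ x; apply: gr_inc_surj.
apply: (fin_gen_surj (f := g)) => y; have [x xE] := fi_pi_surj (gr_inc V i i y).
by exists x; apply: (@gr_inc_inj _ V i i); rewrite -xE; apply: (gE tt).
Qed.

End FinitelyGenerated.

(** * The finiteness criterion and the dimension formula *)

Local Open Scope ereal_scope.

Theorem theorem1p5 (k : comNzRingType) (V : fimod k) (n : nat)
    (k_noetherian : noetherian k) (k_findim : findim k < +oo)
    (V_fin_gen : fi_fin_gen V) (V_gd : gd V = ext_nat n) :
  (fi_pd V < +oo <->
   forall i : nat, (i <= n)%N ->
     fi_iso (gr V i) (ind (fi_at (gr V i) i : lmodType (grpalg k i))) /\
     pd (fi_at (gr V i) i : lmodType (grpalg k i)) < +oo) /\
  (fi_pd V < +oo ->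
   [/\ fi_pd V = \big[maxe/-oo]_(i < n.+1)
                   pd (fi_at (gr V i) i : lmodType (grpalg k i)),
       \big[maxe/-oo]_(i < n.+1)
         pd (fi_at (gr V i) i : lmodType (grpalg k i)) =
       \big[maxe/-oo]_(i < n.+1) pd (gr V i i : lmodType k)
     & \big[maxe/-oo]_(i < n.+1) pd (gr V i i : lmodType k) <= findim k]).
Proof.
have V0 : forall j (x : H0 V j), (n < j)%N -> x = 0%R.
  move=> j x nj; have [//|/eqP x0] := eqVneq x 0%R.
  suff : ext_nat j <= gd V by rewrite V_gd ext_nat_le leqNgt nj.
  apply: ext_nat_sup => [_ [m _ <-]|]; first by exists m.
  by exists j => //; exists x.
have V_le d := fi_pd_leP d (filt_full V0).
have fin : fi_pd V < +oo -> forall i : 'I_n.+1,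
    fi_iso (gr V i) (ind (fi_at (gr V i) i : lmodType (grpalg k i))) /\
    pd (fi_at (gr V i) i : lmodType (grpalg k i)) < +oo.
  move=> /fi_pd_lty[d /V_le h] i; have [iso hi] := h i (ltn_ord i).
  by split=> //; apply/pd_lty; exists d.
pose T i : lmodType (grpalg k i) := fi_at (gr V i) i.
(* The index set is nonempty and every term is at least the default -oo, so the maximum is attained
   and inherits finiteness from a single term. *)
have eqM : exists j : 'I_n.+1, \big[maxe/-oo]_(i < n.+1) pd (T i) = pd (T j).
  have [|j _ ->] := @eq_bigmax _ _ _ -oo ord0 xpredT (fun i : 'I_n.+1 => pd (T i)) isT.
    by move=> i _; apply: leNye.
  by exists j.
have leM (i : 'I_n.+1) : pd (T i) <= \big[maxe/-oo]_(i < n.+1) pd (T i).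
  exact: (le_bigmax _ (fun i : 'I_n.+1 => pd (T i)) i).
split.
  split=> [/fin h i ni|h]; first exact: (h (Ordinal (ni : (i < n.+1)%N))).
  have [j Mj] := eqM; have /pd_lty[d hd] := (h j (ltn_ord j)).2.
  apply/fi_pd_lty; exists d; apply/V_le => i ni; split; first exact: (h i ni).1.
  apply/pd_le_ext_nat; apply: le_trans (leM (Ordinal ni)) _.
  by rewrite Mj; apply/pd_le_ext_nat.
move=> hV; split.
(* [V_le] with d the attained maximum bounds pd(V) above; with d = pd(V) it bounds each term. *)
- apply/eqP; rewrite eq_le; apply/andP; split.
    have [j Mj] := eqM; have /pd_lty hj := (fin hV j).2.
    have [[_ hn]|[m [Em hm _]]] := pdP (T j); first by have [d /hn] := hj.
    have [[_ hn]|[d [-> hd dn]]] := fi_pdP V.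
      by have /fi_pd_lty[d /hn] := hV.
    rewrite Mj Em ext_nat_le; apply/dn/V_le => i ni.
    split; first exact: (fin hV (Ordinal ni)).1.
    by apply/pd_le_ext_nat; rewrite -Em -Mj; apply: (leM (Ordinal ni)).
  have [j ->] := eqM.
  have [[-> _]|[d [-> hd _]]] := fi_pdP V; first exact: leey.
  by apply/pd_le_ext_nat; have [_] := (V_le d).1 hd j (ltn_ord j).
- by apply: eq_bigr => i _; apply/pd_restr/(fin hV i).2.
(* Each value is a finitely generated k-module of finite projective dimension, hence one of those
   over which [findim k] is the supremum. *)
- apply/bigmax_leP; split=> [|i _]; first exact: leNye.
  apply: ext_nat_sup => [_ [M [_ <- /pd_lty[d hd]]]|].
    have [[_ hn]|[m [-> _ _]]] := pdP M; first by have := hn _ hd.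
    by exists m.
  exists (gr V i i); split=> //; first exact: gr_fin_gen.
  by rewrite -pd_restr; apply: (fin hV i).2.
Qed.
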